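(* Let $\mathbb{F}_q$ be a finite field of characteristic $3$ and let $\mathcal{F}=\mathbb{F}_q(x,y)$ be a cubic function field given in standard form by $y^3-Ay+B=0$ with $A,B\in\mathbb{F}_q[x]$. Let $P$ be a finite place of $\mathbb{F}_q(x)$, $m_1=v_P(A)$, $m_0=v_P(B)$, and let $\bar A=A \bmod P$, $\bar B=B\bmod P$. Then the $P$-signature of $\mathcal{F}/\mathbb{F}_q(x)$ is: \begin{itemize} \item $(1,1,1,1,1,1)$ if $m_1=0<m_0$ and $A$ is a square modulo $P$; or if $m_1=m_0=0$ and $T^3-\bar AT+\bar B$ has $3$ roots in $\mathbb{F}_{q^{\deg(P)}}$. \item $(1,1,1,2)$ if $m_1=0<m_0$ and $A$ is not a square modulo $P$; or if $m_1=m_0=0$ and $T^3-\bar AT+\bar B$ has $1$ root in $\mathbb{F}_{q^{\deg(P)}}$. \item $(1,1,2,1)$ if $m_1=1<m_0$. \item $(1,3)$ if $m_1=m_0=0$ and $T^3-\bar AT+\bar B$ has no roots in $\mathbb{F}_{q^{\deg(P)}}$. \item $(3,1)$ if $1\le m_0\le m_1$. \end{itemize} (No assertion is made in the case $m_0=0<m_1$.)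
   Context: Cubic function field in standard form: $\mathcal{F}=\mathbb{F}_q(x,y)$ where $x$ is transcendental over $\mathbb{F}_q$, $T^3-A(x)T+B(x)\in\mathbb{F}_q[x][T]$ is irreducible over $\mathbb{F}_q(x)$ with root $y$, at least one of $A,B$ is non-constant, there is no non-constant $Q\in\mathbb{F}_q[x]$ with $Q^2\mid A$ and $Q^3\mid B$, and $\mathbb{F}_q$ is algebraically closed in $\mathcal{F}$. Finite places of $\mathbb{F}_q(x)$ are identified with monic irreducible polynomials $P\in\mathbb{F}_q[x]$; $v_P(G)$ is the exact power of $P$ dividing $G$ ($v_P(0)=\infty$), and the residue field $\mathbb{F}_q[x]/(P)$ is identified with $\mathbb{F}_{q^{\deg(P)}}$. The $P$-signature of $\mathcal{F}/\mathbb{F}_q(x)$ is the list of pairs $(e(P_i|P),f(P_i|P))$ of ramification indices and relative (residue) degrees of all places $P_1,\dots,P_m$ of $\mathcal{F}$ above $P$, written as one tuple and ordered lexicographically; e.g. $(1,1,2,1)$ means two places, one with $e=f=1$ and one with $e=2$, $f=1$. *)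

(* Defs.v *)
From HB Require Import structures.
From mathcomp Require Import all_boot all_order all_algebra all_field.
From mathcomp Require Import classical_sets constructive_ereal.

Set Implicit Arguments.
Unset Strict Implicit.
Unset Printing Implicit Defensive.

Import Order.TTheory GRing.Theory Num.Theory.

Local Open Scope classical_set_scope.
Local Open Scope ring_scope.

Definition cubic (R : nzRingType) (A B : R) : {poly R} :=
  'X^3 - A *: 'X + B%:P.

(* v_P(G), with v_P(0) = +oo. When P is not constant and G != 0, every power of
   P dividing G has exponent below size G, so the maximum runs over all of them. *)
Definition vpoly (k : fieldType) (P G : {poly k}) : \bar int :=
  if G == 0 then +oo%E
  else ((\max_(i < size G | (P ^+ i %| G)%R) i)%N%:Z)%:E.

Section ValuationRings.
Variables (L : fieldType) (O : set L).

Definition vunit (u : L) : Prop := [/\ u != 0, O u & O u^-1].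

Definition maxideal : set L := [set z | O z /\ ~ vunit z].

Definition uniformizer (t : L) : Prop := maxideal = [set t * z | z in O].

(* The normalized discrete valuation of the valuation ring O takes the finite
   value n at z. *)
Definition has_val (z : L) (n : int) : Prop :=
  exists t u : L, [/\ uniformizer t, vunit u & z = u * t ^ n].

End ValuationRings.

Section PlaceExtensions.
Variables (K : fieldType) (L : fieldExtType K) (O : set K) (O' : set L).

Definition lies_over : Prop :=
  forall z : K, maxideal O z -> maxideal O' z%:A.

Definition ramification_index (e : nat) : Prop :=
  forall (z : K) (n : int), has_val O z n -> has_val O' z%:A (e%:Z * n).

(* f is the dimension of O'/maxideal O' over O/maxideal O: the classes of the
   family w form a basis. *)
Definition relative_degree (f : nat) : Prop :=
  exists w : 'I_f -> L,
    [/\ forall i, O' (w i),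
        forall z, O' z -> exists2 a : 'I_f -> K,
          forall i, O (a i) & maxideal O' (z - \sum_i a i *: w i)
      & forall a : 'I_f -> K, (forall i, O (a i)) ->
          maxideal O' (\sum_i a i *: w i) -> forall i, maxideal O (a i)].

End PlaceExtensions.

Section FunctionFields.
Variables (k : finFieldType) (F : fieldExtType {fraction {poly k}}).

Definition constant_embedding (c : k) : F := (tofrac c%:P)%:A.

Record cubic_standard_form (A B : {poly k}) (y : F) : Prop := {
  csf_irreducible : irreducible_poly (map_poly (@tofrac {poly k}) (cubic A B));
  csf_root : root (cubic (tofrac A)%:A (tofrac B)%:A) y;
  csf_generated : <<1; y>>%VS = {:F}%VS;
  csf_nonconstant : (1 < size A)%N \/ (1 < size B)%N;
  csf_standard : forall Q : {poly k},
    Q ^+ 2 %| A -> Q ^+ 3 %| B -> (size Q <= 1)%N;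
  csf_constants : forall z : F, algebraicOver constant_embedding z ->
    exists c : k, z = constant_embedding c
}.

(* A place of F is represented by its valuation ring. *)
Definition is_place (O : set F) : Prop :=
  [/\ GRing.subring_closed (mem O),
      range constant_embedding `<` O,
      O `<` setT
    & forall z : F, O z \/ O z^-1].

(* The valuation ring of F_q(x) at the finite place P. *)
Definition finite_place (P : {poly k}) : set {fraction {poly k}} :=
  [set z | exists G H : {poly k}, ~~ (P %| H) /\ z = tofrac G / tofrac H].

(* The tuple (e_1,f_1,...,e_m,f_m) is encoded as the sequence of its pairs;
   Q enumerates the places above P without repetition. *)
Definition signature (P : {poly k}) (s : seq (nat *l nat)) : Prop :=
  sorted <=%O s /\
  exists Q : 'I_(size s) -> set F,
    [/\ injective Q,
        range Q = [set O | is_place O /\ lies_over (finite_place P) O]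
      & forall i, let: (e, f) := tnth (in_tuple s) i in
          ramification_index (finite_place P) (Q i) e /\
          relative_degree (finite_place P) (Q i) f].

End FunctionFields.

Section ResidueField.
Variables (k : finFieldType) (P : {poly k}) (hP : monic_irreducible_poly P).

Definition residue (G : {poly k}) : {poly %/ P with hP} := in_qpoly P G.

Definition square_mod (A : {poly k}) : Prop :=
  exists c : {poly %/ P with hP}, residue A = c ^+ 2.

Definition nroots_mod (A B : {poly k}) : nat :=
  #|[pred t | root (cubic (residue A) (residue B)) t]|.

End ResidueField.

(* Main.v *)
From HB Require Import structures.
Require Import Defs.
From mathcomp Require Import all_boot all_order all_algebra all_field.
From mathcomp Require Import boolp classical_sets constructive_ereal.
From mathcomp Require Import ring.

Set Implicit Arguments.
Unset Strict Implicit.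
Unset Printing Implicit Defensive.

Import Order.TTheory GRing.Theory Num.Theory.

Local Open Scope classical_set_scope.
Local Open Scope ring_scope.

(** Every place of F above P is the localization of a suitable order R of F at a
    maximal ideal containing P, so the signature is read off from the way P
    decomposes in R.

    The orders are R = k[x] + k[x] y + k[x] theta with theta = y^2 / c, where
    A = c a and B = c^2 b; then y^2 = c theta, y theta = a y - c b and
    theta^2 = a theta - b y, so R is a ring, integral over k[x].  The choice c = 1
    gives k[x][y]; the choice c = P is needed when P^2 divides B and P divides A,
    because k[x][y] is then not integrally closed above P.

    A maximal ideal M of R above P is the kernel of a residue map from R to a
    finite field (residue_kernel).  If a single t generates M locally, the
    localization of R at M is a discrete valuation ring with uniformizer t
    (localization_valuation_ring, localization_uniformizer); writing P as a local
    unit times t^e gives the ramification index e, and the image of R in the finite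
    field gives the residue degree.  Conversely a valuation ring O above P contains
    the integral ring R; if the intersection of the chosen ideals M is nil modulo P,
    the maximal ideal of O contains one of them, and O is then the localization at
    it (signature_of_decomposition).

    It remains to exhibit the ideals.
    - If P does not divide A, take c = 1.  Modulo P the polynomial T^3 - A T + B has
      derivative - A in characteristic 3, hence is separable, and each of its
      irreducible factors over the residue field of P gives an unramified prime,
      whose residue degree is the degree of the factor
      (unramified_decomposition).  If it has a root r it equals
      (T - r) ((T - r)^2 - A), so the other roots are rational or not according to
      whether A is a square.
    - If v_P(A) = 1 and P^2 divides B, take c = P.  Modulo P the ring is spanned by
      1, y, theta with y^2 = 0 and theta (theta - a) a multiple of y, where a is a
      unit: there is an unramified prime with theta = 0 and a prime with theta = a,
      where P theta = y^2 shows that y is a uniformizer and e = 2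
      (decomposition_partially_ramified).
    - If v_P(B) = 1 and P divides A, then y^3 = A y - B is a unit times P, so y is a
      uniformizer with e = 3 (decomposition_totally_ramified_val1).  If
      v_P(B) = 2 and A = P^2 a', the same holds for theta = y^2 / P: writing
      B = P^2 b one finds theta^3 = P (a' y - b)^2, where b is prime to P
      (decomposition_totally_ramified_val2).  Since the form is standard,
      1 <= v_P(B) <= v_P(A) leaves no other possibility. *)

(** * Subrings and valuation rings of a field *)

Definition subring (L : fieldType) (R : set L) : Prop :=
  [/\ R 1, forall x y, R x -> R y -> R (x - y)
    & forall x y, R x -> R y -> R (x * y)].

Section Subrings.
Variables (L : fieldType) (R : set L).
Hypothesis subR : subring R.

Lemma subring1 : R 1. Proof. by case: subR. Qed.
Lemma subringB x y : R x -> R y -> R (x - y). Proof. by case: subR x y. Qed.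
Lemma subringM x y : R x -> R y -> R (x * y). Proof. by case: subR x y. Qed.
Lemma subring0 : R 0.
Proof. by rewrite -(subrr 1); apply: subringB; apply: subring1. Qed.
Lemma subringN x : R x -> R (- x).
Proof. by move=> Rx; rewrite -sub0r; apply: subringB => //; apply: subring0. Qed.
Lemma subringD x y : R x -> R y -> R (x + y).
Proof. by move=> Rx Ry; rewrite -[y]opprK; apply: subringB => //; apply: subringN. Qed.
Lemma subringX x n : R x -> R (x ^+ n).
Proof.
move=> Rx; elim: n => [|n IHn]; first exact: subring1.
by rewrite exprS; apply: subringM.
Qed.

Lemma vunit1 : vunit R 1.
Proof. by split; rewrite ?oner_neq0 ?invr1 //; apply: subring1. Qed.
Lemma vunitM u v : vunit R u -> vunit R v -> vunit R (u * v).
Proof.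
case=> u0 Ru Ru' [v0 Rv Rv']; split; first by rewrite mulf_neq0.
  exact: subringM.
by rewrite invfM; apply: subringM.
Qed.
Lemma vunitV u : vunit R u -> vunit R u^-1.
Proof. by case=> u0 Ru Ru'; split; rewrite ?invr_eq0 ?invrK. Qed.
Lemma vunitX u n : vunit R u -> vunit R (u ^+ n).
Proof.
move=> uu; elim: n => [|n IHn]; first exact: vunit1.
by rewrite exprS; apply: vunitM.
Qed.
Lemma vunitXz u (n : int) : vunit R u -> vunit R (u ^ n).
Proof. by case: n => n uu; [|apply: vunitV]; apply: vunitX. Qed.

Lemma uniformizer_mem t : uniformizer R t -> maxideal R t.
Proof. by move->; exists 1; [apply: subring1 | rewrite mulr1]. Qed.

(** Valuations may be computed with any uniformizer: has_val quantifies over one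
    that is not fixed in advance. *)
Lemma uniformizer_assoc t t' : t != 0 -> uniformizer R t -> uniformizer R t' ->
  exists2 u, vunit R u & t' = u * t.
Proof.
move=> t0 Ut Ut'.
have /[!Ut][[z Rz ztE]] := uniformizer_mem Ut'.
have /[!Ut'][[z' Rz' ztE']] := uniformizer_mem Ut.
have zz' : z * z' = 1.
  by apply: (mulfI t0); rewrite mulrA ztE ztE' mulr1.
have z0 : z != 0.
  by apply/eqP => z0; move: zz'; rewrite z0 mul0r => /esym/eqP; rewrite oner_eq0.
exists z; last by rewrite mulrC ztE.
by split=> //; rewrite -[z^-1]mulr1 -zz' mulKf.
Qed.

End Subrings.

Definition valuation_ring (L : fieldType) (O : set L) : Prop :=
  subring O /\ forall z, O z \/ O z^-1.

Section ValuationRingTheory.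
Variables (L : fieldType) (O : set L).
Hypothesis valO : valuation_ring O.
Let subO : subring O := valO.1.
Let m := maxideal O.

Lemma maxideal_not1 : ~ m 1.
Proof. by case=> _; apply; apply: vunit1 subO. Qed.

Lemma maxidealMl x y : O x -> m y -> m (x * y).
Proof.
move=> Ox [Oy nuy]; split; first exact: subringM.
move=> [xy0 Oxy Oxy']; apply: nuy; split=> //.
  by apply: contraNneq xy0 => ->; rewrite mulr0.
have x0 : x != 0 by apply: contraNneq xy0 => ->; rewrite mul0r.
have -> : y^-1 = x * (x * y)^-1 by rewrite invfM mulrA divff // mul1r.
exact: subringM.
Qed.

Lemma maxideal_prime x y : O x -> O y -> m (x * y) -> m x \/ m y.
Proof.
move=> Ox Oy [_ nu]; have [mx|nx] := pselect (m x); first by left.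
right; split=> // uy; apply: nu; apply: vunitM => //.
by apply: contrapT => nux; apply: nx.
Qed.

Lemma maxideal0 : m 0.
Proof. by split; [apply: subring0 | case=> /eqP]. Qed.

Lemma maxidealX x n : O x -> m (x ^+ n) -> m x.
Proof.
move=> Ox; elim: n => [/maxideal_not1 //|n IHn]; rewrite exprS => mx.
by case: (maxideal_prime Ox (subringX subO n Ox) mx).
Qed.

Lemma maxidealN x : m x -> m (- x).
Proof.
by move=> mx; rewrite -mulN1r; apply: maxidealMl (subringN _ (subring1 _)) _.
Qed.

(** Of the two quotients x / y and y / x one lies in O, so that the sum is a
    multiple in O of x or of y. *)
Lemma maxidealD x y : m x -> m y -> m (x + y).
Proof.
have main u v : m u -> m v -> u != 0 -> O (v / u) -> m (u + v).
  move=> mu mv u0 Ovu.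
  have -> : u + v = (1 + v / u) * u by rewrite mulrDl mul1r divfK.
  by apply: maxidealMl => //; apply: subringD => //; apply: subring1.
move=> mx my; have [->|x0] := eqVneq x 0; first by rewrite add0r.
have [->|y0] := eqVneq y 0; first by rewrite addr0.
have [Oyx|] := valO.2 (y / x); first exact: main.
by rewrite invf_div => Oxy; rewrite addrC; apply: main.
Qed.

Lemma maxidealB x y : m x -> m y -> m (x - y).
Proof. by move=> mx my; apply: maxidealD => //; apply: maxidealN. Qed.

Lemma maxideal_inv z : ~ O z -> m z^-1.
Proof.
move=> nOz; have [//|Ozi] := valO.2 z; split=> //.
by case=> _ _; rewrite invrK.
Qed.

Lemma unit_of_inverse_mod x y : O x -> O y -> m (x * y - 1) -> vunit O x.
Proof.
move=> Ox Oy mxy; apply: contrapT => nux; have mx : m x by [].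
apply: maxideal_not1.
have -> : 1 = y * x - (x * y - 1) by ring.
by apply: maxidealB => //; apply: maxidealMl.
Qed.

(** If z lies in the larger ring but not in the smaller one, then z^-1 lies in the
    smaller maximal ideal, hence in the larger one, which would then contain 1. *)
Lemma valuation_ring_maximal (O1 : set L) : valuation_ring O1 -> O1 `<=` O ->
  maxideal O1 `<=` m -> O1 = O.
Proof.
move=> valO1 sO1 sm; apply/seteqP; split=> // z Oz.
apply: contrapT => nz.
have ziO1 : maxideal O1 z^-1.
  by have [//|Ozi] := valO1.2 z; split=> //; case=> _ _; rewrite invrK.
have z0 : z != 0 by apply/eqP => z0; apply: nz; rewrite z0; apply: subring0 valO1.1.
apply: maxideal_not1; rewrite -(divff z0); apply: maxidealMl => //; exact: sm.
Qed.

End ValuationRingTheory.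

(** * Localization at a maximal ideal *)

(** Maximality is the existence of inverses modulo M; it makes M prime and provides
    the approximations that compute residue fields. *)
Definition maximal_ideal (L : fieldType) (R M : set L) : Prop :=
  [/\ M `<=` R, M 0, forall x y, M x -> M y -> M (x - y),
      forall x y, R x -> M y -> M (x * y)
    & ~ M 1 /\ forall s, R s -> ~ M s -> exists2 s', R s' & M (s * s' - 1)].

Definition localization (L : fieldType) (R M : set L) : set L :=
  [set z | exists a s, [/\ R a, R s, ~ M s & z = a / s]].

(** The ideal generated by t becomes M after localization: an element of M is a
    multiple of t up to a factor outside M. *)
Definition locally_generates (L : fieldType) (R M : set L) (t : L) : Prop :=
  M t /\ forall w, M w -> exists s w1, [/\ R s, ~ M s, R w1 & s * w = t * w1].

Section Localization.
Variables (L : fieldType) (R M : set L).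
Hypotheses (subR : subring R) (maxM : maximal_ideal R M).

Lemma ideal_sub : M `<=` R. Proof. by case: maxM. Qed.
Lemma ideal0 : M 0. Proof. by case: maxM. Qed.
Lemma idealB x y : M x -> M y -> M (x - y). Proof. by case: maxM x y. Qed.
Lemma idealMl x y : R x -> M y -> M (x * y). Proof. by case: maxM x y. Qed.
Lemma ideal_not1 : ~ M 1. Proof. by case: maxM => _ _ _ _ []. Qed.
Lemma ideal_inverse s : R s -> ~ M s -> exists2 s', R s' & M (s * s' - 1).
Proof. by case: maxM => _ _ _ _ [_]; apply. Qed.
Lemma idealN x : M x -> M (- x).
Proof. by move=> Mx; rewrite -sub0r; apply: idealB => //; apply: ideal0. Qed.
Lemma idealD x y : M x -> M y -> M (x + y).
Proof. by move=> Mx My; rewrite -[y]opprK; apply: idealB => //; apply: idealN. Qed.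

Lemma notin_neq0 s : ~ M s -> s != 0.
Proof. by move=> nMs; apply/eqP => s0; apply: nMs; rewrite s0; apply: ideal0. Qed.

Lemma ideal_prime s s' : R s -> R s' -> M (s * s') -> M s \/ M s'.
Proof.
move=> Rs Rs' Mss'; have [Ms|nMs] := pselect (M s); [by left | right].
have [u Ru Msu] := ideal_inverse Rs nMs.
have -> : s' = u * (s * s') - s' * (s * u - 1) by ring.
by apply: idealB; apply: idealMl.
Qed.

Lemma notinM s s' : R s -> R s' -> ~ M s -> ~ M s' -> ~ M (s * s').
Proof. by move=> Rs Rs' nMs nMs' /(ideal_prime Rs Rs') []. Qed.

Lemma notinX s n : R s -> ~ M s -> ~ M (s ^+ n).
Proof.
move=> Rs nMs; elim: n => [|n IHn]; first exact: ideal_not1.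
by rewrite exprS; apply: notinM => //; apply: subringX.
Qed.

Local Notation O := (localization R M).

Lemma sub_localization : R `<=` O.
Proof.
move=> a Ra; exists a, 1; split; rewrite ?divr1 //; [exact: subring1 | exact: ideal_not1].
Qed.

Lemma localization_subring : subring O.
Proof.
split; first exact: sub_localization (subring1 subR).
- move=> _ _ [a [s [Ra Rs nMs ->]]] [b [u [Rb Ru nMu ->]]].
  exists (a * u - b * s), (s * u); split; [|exact: subringM|exact: notinM|].
    by apply: subringB => //; apply: subringM.
  by field; rewrite !notin_neq0.
- move=> _ _ [a [s [Ra Rs nMs ->]]] [b [u [Rb Ru nMu ->]]].
  exists (a * b), (s * u); split; [exact: subringM|exact: subringM|exact: notinM|].
  by field; rewrite !notin_neq0.
Qed.

Lemma localization_unitP z : vunit O z <->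
  exists a s, [/\ R a, R s, ~ M a, ~ M s & z = a / s].
Proof.
split=> [[z0 [a [s [Ra Rs nMs zE]]] [b [u [Rb Ru nMu zE']]]]|].
  exists a, s; split=> // Ma; apply: (notinM Rs Ru nMs nMu).
  have a0 : a != 0 by apply: contraNneq z0; rewrite zE => ->; rewrite mul0r.
  suff -> : s * u = b * a by apply: idealMl.
  move: zE'; rewrite zE invf_div => /(congr1 (fun x => x * u * a)).
  rewrite (divfK (notin_neq0 nMu)) => <-.
  by field.
case=> a [s [Ra Rs nMa nMs ->]]; split.
- by rewrite mulf_neq0 ?invr_eq0 ?notin_neq0.
- by exists a, s.
- by exists s, a; rewrite invf_div.
Qed.

Lemma localization_maxidealP z : maxideal O z <->
  exists a s, [/\ M a, R s, ~ M s & z = a / s].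
Proof.
split=> [[[a [s [Ra Rs nMs zE]]] nu]|[a [s [Ma Rs nMs zE]]]].
  exists a, s; split=> //; apply: contrapT => nMa; apply: nu.
  by apply/localization_unitP; exists a, s.
split; first by exists a, s; split=> //; apply: ideal_sub.
case/localization_unitP=> b [u [Rb Ru nMb nMu zE']].
apply: (notinM Rs Rb nMs nMb); suff -> : s * b = u * a by apply: idealMl.
move: zE'; rewrite zE => /(congr1 (fun x => x * u * s)).
rewrite mulrAC (divfK (notin_neq0 nMs)) mulrC => ->.
by rewrite (divfK (notin_neq0 nMu)) mulrC.
Qed.

Lemma sub_maxideal_localization : M `<=` maxideal O.
Proof.
move=> w Mw; apply/localization_maxidealP; exists w, 1; rewrite divr1.
by split=> //; [apply: subring1 | apply: ideal_not1].
Qed.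

Lemma maxideal_localizationI z : R z -> maxideal O z -> M z.
Proof.
move=> Rz /localization_maxidealP [a [s [Ma Rs nMs zE]]].
have: M (z * s) by rewrite zE divfK // notin_neq0.
by case/(ideal_prime Rz Rs).
Qed.

(** R and its localization have the same residue field, because elements outside M
    are already invertible modulo M. *)
Lemma localization_approx z : O z -> exists2 a, R a & maxideal O (z - a).
Proof.
case=> a [s [Ra Rs nMs ->]]; have [u Ru Msu] := ideal_inverse Rs nMs.
exists (a * u); first exact: subringM.
apply/localization_maxidealP; exists ((- a) * (s * u - 1)), s; split=> //.
  by apply: idealMl => //; apply: subringN.
by field; apply: notin_neq0.
Qed.

Variable t : L.
Hypothesis tM : locally_generates R M t.

Lemma localization_uniformizer : uniformizer O t.
Proof.
have [Mt gen] := tM; apply/seteqP; split=> z.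
  case/localization_maxidealP=> w [s [Mw Rs nMs ->]].
  have [s1 [w1 [Rs1 nMs1 Rw1 E]]] := gen w Mw.
  exists (w1 / (s1 * s)).
    by exists w1, (s1 * s); split=> //; [apply: subringM | apply: notinM].
  have -> : w = t * w1 / s1 by rewrite -[LHS](mulKf (notin_neq0 nMs1)) E mulrC.
  by field; rewrite !notin_neq0.
case=> _ [a [s [Ra Rs nMs ->]]] <-; apply/localization_maxidealP.
exists (a * t), s; split=> //; first exact: idealMl.
by rewrite mulrA [t * a]mulrC.
Qed.

Hypothesis t0 : t != 0.

Lemma localization_proper : ~ O t^-1.
Proof.
case=> a [s [Ra Rs nMs E]]; apply: nMs.
suff -> : s = a * t by apply: idealMl => //; case: tM.
have s0 : s != 0 by move: t0; rewrite -invr_eq0 E mulf_eq0 invr_eq0 => /norP[].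
by rewrite -[a](divfK s0) -E mulrAC mulVf ?mul1r.
Qed.

(** Dividing w repeatedly by t must stop: each division lowers by one the power of t
    that w is known to divide. *)
Lemma divides_power_factor N w w' s : R w -> R w' -> R s -> ~ M s ->
  w * w' = t ^+ N * s ->
  exists n a b, [/\ R a, ~ M a, R b, ~ M b & b * w = a * t ^+ n].
Proof.
have [Mt gen] := tM.
elim: N w s => [|N IHN] w s Rw Rw' Rs nMs E; have [Mw|nMw] := pselect (M w);
  try by exists 0%N, w, 1; rewrite mulr1 mul1r; split=> //;
         [apply: subring1 | apply: ideal_not1].
  case: nMs; have <- : w' * w = s by rewrite mulrC E mul1r.
  exact: idealMl.
have [s1 [w1 [Rs1 nMs1 Rw1 E1]]] := gen w Mw.
have E2 : w1 * w' = t ^+ N * (s1 * s).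
  apply: (mulfI t0); rewrite [LHS]mulrA -E1 -mulrA E exprS; ring.
have [n [a [b [Ra nMa Rb nMb Eb]]]] :=
  IHN w1 _ Rw1 Rw' (subringM subR Rs1 Rs) (notinM Rs1 Rs nMs1 nMs) E2.
exists n.+1, a, (b * s1); split=> //; [exact: subringM|exact: notinM|].
by rewrite -mulrA E1 mulrCA Eb mulrCA -exprS.
Qed.

Hypothesis fracR : forall z, exists a d, [/\ R a, R d, d != 0 & z = a / d].
Hypothesis divR : forall w, R w -> w != 0 ->
  exists N w' s, [/\ R w', R s, ~ M s & w * w' = t ^+ N * s].

(** Every nonzero element is a local unit times a power of t, as numerator and
    denominator both divide a power of t up to a local unit. *)
Lemma localization_valuation_ring : valuation_ring O.
Proof.
split; first exact: localization_subring.
have Rt : R t by case: tM => /ideal_sub.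
have fac w : R w -> w != 0 -> exists n a b,
    [/\ R a, ~ M a, R b, ~ M b & b * w = a * t ^+ n].
  move=> Rw w0; have [N [w' [s [Rw' Rs nMs E]]]] := divR Rw w0.
  exact: divides_power_factor E.
move=> z; have [a [d [Ra Rd d0 ->]]] := fracR z.
have [->|a0] := eqVneq a 0; first by left; rewrite mul0r; apply: subring0 localization_subring.
have [n [p [q [Rp nMp Rq nMq Ea]]]] := fac a Ra a0.
have [l [p' [q' [Rp' nMp' Rq' nMq' Ed]]]] := fac d Rd d0.
have q0 := notin_neq0 nMq; have q'0 := notin_neq0 nMq'.
have p0 := notin_neq0 nMp; have p'0 := notin_neq0 nMp'.
have aE : a = p * t ^+ n / q by rewrite -[LHS](mulKf q0) Ea mulrC.
have dE : d = p' * t ^+ l / q' by rewrite -[LHS](mulKf q'0) Ed mulrC.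
have tn0 i : t ^+ i != 0 by rewrite expf_neq0.
have [le_ln|/ltnW le_nl] := leqP l n; [left|right].
  exists (p * q' * t ^+ (n - l)), (q * p'); split; [| exact: subringM | exact: notinM |].
    exact: (subringM subR (subringM subR Rp Rq') (subringX subR _ Rt)).
  rewrite aE dE -{1}(subnK le_ln) exprD.
  by field; rewrite q0 q'0 p'0 tn0.
exists (p' * q * t ^+ (l - n)), (q' * p); split; [| exact: subringM | exact: notinM |].
  exact: (subringM subR (subringM subR Rp' Rq) (subringX subR _ Rt)).
rewrite aE dE -{1}(subnK le_nl) exprD.
by field; rewrite q0 q'0 p'0 p0 !tn0.
Qed.

End Localization.

(** * The valuation ring of the rational function field at P *)

Lemma irreducible_power_factor (k : fieldType) (P W : {poly k}) :
  (1 < size P)%N -> W != 0 -> exists N s, ~~ (P %| s) /\ W = P ^+ N * s.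
Proof.
move=> szP; have [n] := ubnP (size W); elim: n W => // n IHn W leW W0.
have [/dvdpP[V WE]|ndv] := boolP (P %| W); last first.
  by exists 0%N, W; rewrite mul1r.
have V0 : V != 0 by apply: contraNneq W0; rewrite WE => ->; rewrite mul0r.
have P0 : P != 0 by rewrite -size_poly_gt0 ltnW.
have [|//|N [s [nPs VE]]] := IHn V.
  apply: leq_trans (_ : size W <= n)%N; last by rewrite -ltnS.
  rewrite WE size_mul //; case: (size P) szP => [|[|j]] // _.
  by rewrite !addnS /= ltnS leq_addr.
by exists N.+1, s; split; rewrite // WE VE exprSr mulrAC.
Qed.

(** It suffices to compare one uniformizer below with one above; the others differ
    from them by units. *)
Lemma ramification_of_uniformizers (K : fieldType) (L : fieldExtType K)
    (O : set K) (O' : set L) (t : K) (t' v : L) (e : nat) :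
  subring O -> subring O' -> t != 0 -> uniformizer O t -> uniformizer O' t' ->
  (forall u, vunit O u -> vunit O' u%:A) ->
  vunit O' v -> t%:A = v * t' ^+ e -> ramification_index O O' e.
Proof.
move=> subO subO' t0 Ut Ut' unitA uv tE z n [tau [u [Utau uu ->]]].
have [w uw ->] := uniformizer_assoc subO t0 Ut Utau.
exists t', ((u * w ^ n)%:A * v ^ n); split=> //.
  apply: vunitM => //; last exact: vunitXz.
  by apply: unitA; apply: vunitM => //; apply: vunitXz.
have algM x x' : (x * x')%:A = x%:A * x'%:A :> L by rewrite -scalerAl mul1r scalerA.
have algX x i : (x ^ i)%:A = x%:A ^ i :> L := fmorphXz (in_alg L) i x.
rewrite expfzMl mulrA algM -mulrA; congr (_ * _).
by rewrite algX tE expfzMl exprnP exprz_exp.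
Qed.

(** Locked, since unfolding it would make conversion compute with fractions of
    polynomials. *)
HB.lock Definition poly_emb (k : fieldType) (F : fieldExtType {fraction {poly k}})
  (p : {poly k}) : F := (tofrac p)%:A.

Section PolyEmb.
Variables (k : fieldType) (F : fieldExtType {fraction {poly k}}).

Lemma poly_embE (p : {poly k}) : poly_emb F p = (tofrac p)%:A.
Proof. by rewrite unlock. Qed.

Fact poly_emb_is_zmod_morphism : zmod_morphism (@poly_emb k F).
Proof. by move=> p q; rewrite !poly_embE rmorphB scalerBl. Qed.

Fact poly_emb_is_monoid_morphism : monoid_morphism (@poly_emb k F).
Proof.
split=> [|p q]; first by rewrite poly_embE rmorph1 scale1r.
by rewrite !poly_embE rmorphM -scalerAl mul1r scalerA.
Qed.

HB.instance Definition _ := GRing.isZmodMorphism.Build {poly k} F (@poly_emb k F)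
  poly_emb_is_zmod_morphism.
HB.instance Definition _ := GRing.isMonoidMorphism.Build {poly k} F (@poly_emb k F)
  poly_emb_is_monoid_morphism.

End PolyEmb.

Section FinitePlace.
Variables (k : finFieldType) (P : {poly k}) (irrP : irreducible_poly P).
Local Notation K := {fraction {poly k}}.
Let Rk : set K := range (@tofrac {poly k}).
Let Mk : set K := [set tofrac p | p in [set p | P %| p]].

Lemma frac_numden (z : K) : exists n d : {poly k}, d != 0 /\ z = tofrac n / tofrac d.
Proof.
elim/quotW: z => r; exists (frac r).1, (frac r).2.
have d0 : (frac r).2 != 0 by apply: denom_ratioP.
split=> //; apply: (canRL (mulfK _)); first by rewrite tofrac_eq0.
unlock FracField.tofrac; rewrite -[LHS]FracField.pi_mul.
apply/eqmodP => /=.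
by rewrite /FracField.equivf /FracField.mulf !numden_Ratio ?mulr1 ?oner_eq0 // mulrC.
Qed.

Lemma tofrac_subring : subring Rk.
Proof.
split; first by exists 1; rewrite ?rmorph1.
- by move=> _ _ [p _ <-] [q _ <-]; exists (p - q); rewrite ?rmorphB.
- by move=> _ _ [p _ <-] [q _ <-]; exists (p * q); rewrite ?rmorphM.
Qed.

Lemma tofrac_maximal : maximal_ideal Rk Mk.
Proof.
have [szP _] := irrP.
have inj (p q : {poly k}) : tofrac p = tofrac q -> p = q.
  by move=> /eqP; rewrite tofrac_eq => /eqP.
split.
- by move=> _ [p _ <-]; exists p.
- by exists 0; rewrite /= ?dvdp0 ?rmorph0.
- by move=> _ _ [p Pp <-] [q Pq <-]; exists (p - q); rewrite /= ?rmorphB ?dvdp_sub.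
- by move=> _ _ [p _ <-] [q Pq <-]; exists (p * q); rewrite /= ?rmorphM ?dvdp_mull.
split.
  case=> p Pp; rewrite -tofrac1 => /inj p1; move: Pp szP.
  by rewrite /= p1 dvdp1 => /eqP ->.
move=> _ [p _ <-] nMp; have ndv : ~~ (P %| p).
  by apply/negP => Pp; apply: nMp; exists p.
have /Bezout_eq1_coprimepP[[u v] /= E] : coprimep p P.
  by rewrite coprimep_sym irreducible_poly_coprime.
exists (tofrac u); first by exists u.
exists (- (v * P)); first by rewrite /= dvdpNr dvdp_mull.
rewrite -rmorphM -tofrac1 -rmorphB -E; congr tofrac; ring.
Qed.

Lemma finite_placeE : finite_place P = localization Rk Mk.
Proof.
apply/seteqP; split=> z.
  case=> G [H [ndv ->]]; exists (tofrac G), (tofrac H); split=> //.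
    by exists G.
    by exists H.
  case=> H' PH' /eqP; rewrite tofrac_eq => /eqP HE.
  by move/negP: ndv; rewrite -HE; apply.
case=> _ [_ [[G _ <-] [H _ <-] nMH ->]]; exists G, H; split=> //.
by apply/negP => PH; apply: nMH; exists H.
Qed.

Lemma finite_place_subring : subring (finite_place P).
Proof.
by rewrite finite_placeE; apply: localization_subring tofrac_subring tofrac_maximal.
Qed.

Lemma finite_place_maxidealP z : maxideal (finite_place P) z <->
  exists G H, [/\ P %| G, ~~ (P %| H) & z = tofrac G / tofrac H].
Proof.
rewrite finite_placeE (localization_maxidealP tofrac_maximal); split.
  case=> _ [_ [[G PG <-] [H _ <-] nMH ->]]; exists G, H; split=> //.
  by apply/negP => PH; apply: nMH; exists H.
case=> G [H [PG ndv ->]]; exists (tofrac G), (tofrac H); split=> //.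
- by exists G.
- by exists H.
case=> H' PH' /eqP; rewrite tofrac_eq => /eqP HE.
by move/negP: ndv; rewrite -HE; apply.
Qed.

Lemma finite_place_unitP z : vunit (finite_place P) z <->
  exists G H, [/\ ~~ (P %| G), ~~ (P %| H) & z = tofrac G / tofrac H].
Proof.
rewrite finite_placeE (localization_unitP tofrac_maximal); split.
  case=> _ [_ [[G _ <-] [H _ <-] nMG nMH ->]]; exists G, H; split=> //.
    by apply/negP => PH; apply: nMG; exists G.
  by apply/negP => PH; apply: nMH; exists H.
have nM (G : {poly k}) : ~~ (P %| G) -> ~ Mk (tofrac G).
  move=> ndv [G' PG' /eqP]; rewrite tofrac_eq => /eqP GE.
  by move/negP: ndv; rewrite -GE; apply.
case=> G [H [ndvG ndvH ->]]; exists (tofrac G), (tofrac H).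
by split=> //; [exists G | exists H | apply: nM | apply: nM].
Qed.

Lemma finite_place_approx z : finite_place P z ->
  exists p, maxideal (finite_place P) (z - tofrac p).
Proof.
rewrite finite_placeE => /(localization_approx tofrac_subring tofrac_maximal).
by case=> _ [p _ <-]; exists p.
Qed.

Lemma finite_place_uniformizer : uniformizer (finite_place P) (tofrac P).
Proof.
rewrite finite_placeE.
apply: localization_uniformizer tofrac_subring tofrac_maximal _ _.
split; first by exists P => //=; apply: dvdpp.
move=> _ [p /dvdpP[q ->] <-]; exists 1, (tofrac q); split.
- exact: subring1 tofrac_subring.
- exact: ideal_not1 tofrac_maximal.
- by exists q.
- by rewrite mul1r -rmorphM mulrC.
Qed.

End FinitePlace.

(** * Orders with a regular prime above P *)

Lemma in_qpoly_eq0 (k : fieldType) (P : {poly k}) (hP : monic_irreducible_poly P)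
  (p : {poly k}) : (in_qpoly P p == 0) = (P %| p).
Proof.
by rewrite -val_eqE /= -Pdiv.IdomainMonic.modpE (mk_monicE hP) // hP.2.
Qed.

Lemma in_subring_closed (L : fieldType) (O : set L) :
  GRing.subring_closed (mem O) <-> subring O.
Proof.
split=> [[O1 OB OM]|[O1 OB OM]].
  split; first by apply/set_mem; exact: O1.
  - by move=> x y /mem_set Ox /mem_set Oy; apply/set_mem; apply: OB.
  - by move=> x y /mem_set Ox /mem_set Oy; apply/set_mem; apply: OM.
split; first exact: mem_set O1.
- by move=> x y /set_mem Ox /set_mem Oy; apply: mem_set (OB x y Ox Oy).
- by move=> x y /set_mem Ox /set_mem Oy; apply: mem_set (OM x y Ox Oy).
Qed.

Section RegularPrimes.
Variables (k : fieldType) (P : {poly k}) (irrP : irreducible_poly P).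
Variables (L : fieldType) (iota : {rmorphism {poly k} -> L}).

(** The last condition says that R has fraction field L, with denominators in k[x]. *)
Record polynomial_order (R : set L) : Prop := {
  order_subring : subring R;
  order_poly : forall p, R (iota p);
  order_frac : forall z, exists2 d, d != 0 & R (iota d * z)
}.

(** The analogue, in the order itself, of the relative degree of its localization at
    M: R / M has dimension f over k[x] / (P). *)
Definition residue_degree (R M : set L) (f : nat) : Prop :=
  exists w : 'I_f -> L,
    [/\ forall i, R (w i),
        forall z, R z -> exists a : 'I_f -> {poly k}, M (z - \sum_i iota (a i) * w i)
      & forall a : 'I_f -> {poly k}, M (\sum_i iota (a i) * w i) ->
          forall i, P %| a i].

(** M lies above P and its localization is a discrete valuation ring, in which t is
    a uniformizer and P has valuation e. *)
Record regular_prime (R M : set L) (e f : nat) : Prop := {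
  prime_maximal : maximal_ideal R M;
  prime_above : M (iota P);
  prime_uniformizer : exists t, locally_generates R M t /\
    exists s u, [/\ R s, ~ M s, R u, ~ M u & iota P * s = t ^+ e * u];
  prime_residue : residue_degree R M f
}.

(** The last clause says that an element of all the primes is nilpotent modulo P;
    it ensures that no prime above P is missing. *)
Definition prime_decomposition (R : set L) (s : seq (nat *l nat)) : Prop :=
  exists M : 'I_(size s) -> set L,
    [/\ forall i,
          regular_prime R (M i) (tnth (in_tuple s) i).1 (tnth (in_tuple s) i).2,
        forall i j, i != j -> exists z, M i z /\ ~ M j z
      & forall z, (forall i, M i z) -> exists n w, R w /\ z ^+ n = iota P * w].

Hypothesis iota_eq0 : forall p, (iota p == 0) = (p == 0).

Section RegularPrime.
Variables (R M : set L) (e f : nat).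
Hypotheses (ordR : polynomial_order R) (regM : regular_prime R M e f).
Local Notation O := (localization R M).
Let subR := order_subring ordR.
Let maxM := prime_maximal regM.
Let Rp := order_poly ordR.
Let MP := prime_above regM.

Lemma prime_contains p : P %| p -> M (iota p).
Proof.
by move=> /dvdpP[q ->]; rewrite rmorphM; apply: (idealMl maxM) (Rp _) MP.
Qed.

Lemma notin_prime p : ~~ (P %| p) -> ~ M (iota p).
Proof.
move=> ndv Mp; have /Bezout_eq1_coprimepP[[u v] /= E] : coprimep p P.
  by rewrite coprimep_sym irreducible_poly_coprime.
apply: (ideal_not1 maxM); rewrite -(rmorph1 iota) -E rmorphD rmorphM.
apply: (idealD maxM); first exact: (idealMl maxM (Rp _) Mp).
by apply: prime_contains; apply: dvdp_mull.
Qed.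

(** The uniformizer is nonzero, as otherwise e = 0 and P would lie outside M. *)
Lemma uniformizer_data : exists t, [/\ locally_generates R M t, t != 0 &
  exists s u, [/\ R s, ~ M s, R u, ~ M u & iota P * s = t ^+ e * u]].
Proof.
have [t [gen [s [u [Rs nMs Ru nMu E]]]]] := prime_uniformizer regM.
exists t; split=> //; last by exists s, u.
have P0 : P != 0 by rewrite -size_poly_gt0 ltnW // irrP.1.
have: iota P * s != 0 by rewrite mulf_neq0 ?iota_eq0 ?(notin_neq0 maxM).
apply: contraNneq => t0; rewrite E t0; case: (e) E => [|e' _]; last first.
  by rewrite expr0n mul0r.
rewrite mul1r => E; case: nMu; rewrite -E mulrC; exact: (idealMl maxM Rs MP).
Qed.

Lemma prime_valuation_ring : valuation_ring O.
Proof.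
have [t [gen t0 [s [u [Rs nMs Ru nMu E]]]]] := uniformizer_data.
apply: (localization_valuation_ring subR maxM gen t0) => [z|w Rw w0].
  have [d d0 Rdz] := order_frac ordR z.
  exists (iota d * z), (iota d); split=> //; first by rewrite iota_eq0.
  by rewrite mulrC mulKf // iota_eq0.
have [d d0 Rd] := order_frac ordR w^-1.
have [N [d' [ndv dE]]] := irreducible_power_factor irrP.1 d0.
(* The cofactor of w is d w^-1 s^N: with d = P^N d', P s = t^e u turns
   P^N s^N into t^(eN) u^N. *)
exists (e * N)%N, (iota d * w^-1 * s ^+ N), (iota d' * u ^+ N); split.
- exact: (subringM subR Rd (subringX subR N Rs)).
- exact: (subringM subR (Rp d') (subringX subR N Ru)).
- apply: (notinM maxM (Rp d') (subringX subR N Ru)); first exact: notin_prime.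
  exact: (notinX subR maxM Ru nMu).
- have -> : w * (iota d * w^-1 * s ^+ N) = iota d * s ^+ N by field.
  rewrite dE rmorphM rmorphXn [_ ^+ N * _]mulrC -mulrA -exprMn E exprMn exprM.
  by rewrite mulrCA.
Qed.

End RegularPrime.

(** If P R is the intersection of the primes, then P itself generates each of them
    locally: the product of elements of the other primes that avoid M i sends M i
    into all primes, that is into P R. *)
Lemma unramified_decomposition (R : set L) (s : seq (nat *l nat))
    (M : 'I_(size s) -> set L) :
  polynomial_order R ->
  (forall i, [/\ maximal_ideal R (M i), M i (iota P), (tnth (in_tuple s) i).1 = 1%N
     & residue_degree R (M i) (tnth (in_tuple s) i).2]) ->
  (forall i j, i != j -> exists z, M i z /\ ~ M j z) ->
  (forall z, (forall i, M i z) -> exists w, R w /\ z = iota P * w) ->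
  prime_decomposition R s.
Proof.
move=> ordR locM sep int; have subR := order_subring ordR.
have maxM i : maximal_ideal R (M i) by case: (locM i).
exists M; split=> // [i|z /int[w [Rw ->]]].
  have [_ MP e1 degM] := locM i; split=> //; rewrite e1; exists (iota P).
  split; last first.
    by exists 1, 1; split; [| exact: ideal_not1 (maxM i)| | exact: ideal_not1 (maxM i)|];
       first [exact: subring1 | rewrite expr1].
  split=> // w Mw.
  have /fin_all_exists[x xP] j : exists x, j != i -> M j x /\ ~ M i x.
    have [->|ji] := eqVneq j i; first by exists 0.
    by have [x xP] := sep j i ji; exists x.
  have [Rs nMs] : R (\prod_(j | j != i) x j) /\ ~ M i (\prod_(j | j != i) x j).
    apply: (big_ind (fun u => R u /\ ~ M i u)) => [|u v [Ru nu] [Rv nv]|j /xP[Mj nMi]].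
    - by split; [exact: subring1 | exact: ideal_not1 (maxM i)].
    - by split; [exact: subringM | exact: (notinM (maxM i))].
    - by split=> //; exact: (ideal_sub (maxM j)).
  have [|w1 [Rw1 E]] := int (\prod_(j | j != i) x j * w); last first.
    by exists (\prod_(j | j != i) x j), w1.
  move=> j; have [->|ji] := eqVneq j i; first exact: (idealMl (maxM i)).
  have Rw : R w := ideal_sub (maxM i) Mw.
  rewrite (bigD1 j) //= -mulrA mulrC; apply: (idealMl (maxM j)); last by case: (xP j ji).
  apply: subringM => //; apply: (big_ind R) => [|u v Ru Rv|l /andP[li _]].
  - exact: subring1.
  - exact: subringM.
  - by apply: (ideal_sub (maxM l)); case: (xP l li).
by exists 1%N, w; rewrite expr1.
Qed.

End RegularPrimes.

(** * From a decomposition of P in an order to its signature *)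

Section PlacesAbove.
Variables (k : finFieldType) (P : {poly k}) (hP : monic_irreducible_poly P).
Variable F : fieldExtType {fraction {poly k}}.
Local Notation iota := (@poly_emb k F).
Let irrP : irreducible_poly P := hP.1.

Lemma poly_emb_eq0 p : (iota p == 0) = (p == 0).
Proof. by rewrite poly_embE scaler_eq0 tofrac_eq0 oner_eq0 orbF. Qed.

Lemma poly_emb_frac p q : (tofrac p / tofrac q)%:A = iota p / iota q.
Proof.
have algM x x' : (x * x')%:A = x%:A * x'%:A :> F by rewrite -scalerAl mul1r scalerA.
have algV x : x^-1%:A = (x%:A)^-1 :> F := fmorphV (in_alg F) x.
by rewrite !poly_embE algM algV.
Qed.

Lemma place_valuation_ring (O : set F) : is_place O -> valuation_ring O.
Proof. by case=> /in_subring_closed subO _ _ valO. Qed.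

Lemma place_above_max (O : set F) p : lies_over (finite_place P) O ->
  P %| p -> maxideal O (iota p).
Proof.
move=> over Pp; rewrite poly_embE; apply: over; apply/(finite_place_maxidealP irrP).
exists p, 1; split=> //; last by rewrite tofrac1 divr1.
by rewrite dvdp1 neq_ltn irrP.1 orbT.
Qed.

(** The residue field of P is finite with N elements, so that p^N - p is divisible
    by P and lies in the maximal ideal of O: p is integral over O. *)
Lemma place_above_poly (O : set F) : valuation_ring O ->
  lies_over (finite_place P) O -> forall p, O (iota p).
Proof.
move=> valO over p; apply: contrapT => nO.
have Oi := maxideal_inv valO nO; have subO := valO.1.
have p0 : iota p != 0 by apply/eqP => p0; apply: nO; rewrite p0; apply: subring0.
pose kappa := ({poly %/ P with hP} : finFieldType).
have [N NE] : exists N, #|kappa| = N.+2.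
  by case: #|kappa| (finNzRing_gt1 kappa) => [|[|N]] // _; exists N.
have Pq : P %| p ^+ N.+2 - p.
  rewrite -(in_qpoly_eq0 hP) rmorphB rmorphXn subr_eq0 -NE.
  by rewrite (expf_card (in_qpoly P p : kappa)).
have [Oq _] := place_above_max over Pq.
apply: nO.
(* Multiply p^(N+2) = p + q by p^-(N+1), where q = p^(N+2) - p. *)
have -> : iota p = (iota p)^-1 ^+ N + iota (p ^+ N.+2 - p) * (iota p)^-1 ^+ N.+1.
  rewrite rmorphB rmorphXn mulrBl [in X in _ + (_ - X)]exprS mulrA divff // mul1r.
  by rewrite addrC subrK exprS -mulrA -exprMn divff // expr1n mulr1.
by apply: subringD => //; [|apply: subringM => //]; apply: subringX => //; case: Oi.
Qed.

(** Elements of R outside M are invertible modulo M, hence units of O; thus O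
    dominates the localization, which is maximal for domination. *)
Lemma place_above_eq (O : set F) R M : valuation_ring O -> R `<=` O ->
  maximal_ideal R M -> M `<=` maxideal O ->
  valuation_ring (localization R M) -> localization R M = O.
Proof.
move=> valO sRO maxM sMO valL; have subO := valO.1.
have unit s : R s -> ~ M s -> vunit O s.
  move=> Rs nMs; have [u Ru Msu] := ideal_inverse maxM Rs nMs.
  by apply: (unit_of_inverse_mod valO (sRO _ Rs) (sRO _ Ru)); apply: sMO.
apply: valuation_ring_maximal => // z.
  case=> a [s [Ra Rs nMs ->]]; apply: subringM => //; first exact: sRO.
  by case: (unit s Rs nMs).
case/localization_maxidealP=> // a [s [Ma Rs nMs ->]].
rewrite mulrC; apply: maxidealMl => //; last exact: sMO.
by case: (unit s Rs nMs).
Qed.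

Section PlaceOfPrime.
Variables (R M : set F) (e f : nat).
Hypotheses (ordR : polynomial_order (poly_emb F) R).
Hypothesis regM : regular_prime P (poly_emb F) R M e f.
Local Notation O := (localization R M).
Let subR := order_subring ordR.
Let maxM := prime_maximal regM.
Let Rp p : R (iota p) := order_poly ordR p.
Let valO : valuation_ring O := prime_valuation_ring irrP poly_emb_eq0 ordR regM.
Let unifM := uniformizer_data irrP poly_emb_eq0 regM.

Lemma prime_place : is_place O.
Proof.
split; last by case: valO.
- by apply/in_subring_closed; apply: valO.1.
- have constE c : constant_embedding F c = iota c%:P by rewrite poly_embE.
  split; first by move=> _ [c _ <-]; rewrite constE; apply: (sub_localization subR maxM) (Rp _).
  (* The inclusion of the constants is strict because x is not a constant. *)
  move=> /(_ (iota 'X)) [].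
    exact: (sub_localization subR maxM) (Rp _).
  move=> c _ /eqP; rewrite constE -subr_eq0 -rmorphB.
  rewrite poly_emb_eq0 subr_eq0 => /eqP /(congr1 (fun p : {poly k} => size p)).
  by rewrite size_polyX size_polyC; case: eqP.
(* The ring is not all of F, as it does not contain the inverse of t. *)
- split=> // /(_ _ I); have [t [gen t0 _]] := unifM.
  move=> sTO; apply: (localization_proper maxM gen t0); exact: sTO.
Qed.

Lemma prime_unit_above z : vunit (finite_place P) z -> vunit O z%:A.
Proof.
case/(finite_place_unitP irrP)=> G [H [ndvG ndvH ->]].
apply/(localization_unitP maxM); exists (iota G), (iota H).
by split; rewrite ?poly_emb_frac //; apply: (notin_prime irrP ordR regM).
Qed.

Lemma prime_lies_over : lies_over (finite_place P) O.
Proof.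
move=> _ /(finite_place_maxidealP irrP)[G [H [PG ndvH ->]]].
apply/(localization_maxidealP maxM); exists (iota G), (iota H).
split; rewrite ?poly_emb_frac //; first exact: (prime_contains ordR regM).
exact: (notin_prime irrP ordR regM).
Qed.

Lemma prime_ramification : ramification_index (finite_place P) O e.
Proof.
have [t [gen t0 [s [u [Rs nMs Ru nMu E]]]]] := unifM.
have P0 : P != 0 by rewrite -size_poly_gt0 ltnW // irrP.1.
apply: (@ramification_of_uniformizers _ _ _ _ (tofrac P) t (u / s)).
- exact: finite_place_subring.
- exact: valO.1.
- by rewrite tofrac_eq0.
- exact: finite_place_uniformizer.
- exact: localization_uniformizer.
- exact: prime_unit_above.
- by apply/(localization_unitP maxM); exists u, s.
- rewrite -poly_embE; apply: (mulIf (notin_neq0 maxM nMs)).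
  by rewrite E; field; apply: (notin_neq0 maxM nMs).
Qed.

(** Both coefficients in the valuation ring of P and elements of O can be replaced
    by elements of k[x] and of R, up to elements of the maximal ideals. *)
Lemma prime_relative_degree : relative_degree (finite_place P) O f.
Proof.
have [w [Rw span free]] := prime_residue regM.
have Ow i : O (w i) by apply: (sub_localization subR maxM).
have sumE (a : 'I_f -> {poly k}) :
    \sum_i tofrac (a i) *: w i = \sum_i iota (a i) * w i.
  by apply: eq_bigr => i _; rewrite poly_embE -scalerAl mul1r.
exists w; split=> // [z Oz | a Oa ma].
  have [z' Rz' mz] := localization_approx subR maxM Oz.
  have [a Ma] := span z' Rz'; exists (fun i => tofrac (a i)).
    move=> i; rewrite finite_placeE //.
    by apply: (sub_localization (tofrac_subring k) (tofrac_maximal irrP)); exists (a i).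
  rewrite sumE -(subrKA z'); apply: maxidealD => //.
  exact: (sub_maxideal_localization subR maxM).
have /fin_all_exists[b mb] i := finite_place_approx irrP (Oa i).
have Mb : M (\sum_i iota (b i) * w i).
  apply: (maxideal_localizationI maxM).
    apply: (big_ind R) => [|x y Rx Ry|i _]; first exact: subring0.
      exact: subringD.
    exact: subringM.
  rewrite -sumE -[X in maxideal _ X](subKr (\sum_i a i *: w i)).
  apply: maxidealB => //; rewrite -sumrB.
  apply: (big_ind (maxideal O)) => [|x y mx my|i _].
  - exact: maxideal0.
  - exact: maxidealD.
  - rewrite -scalerBl -[w i]mul1r scalerAl mulrC; apply: maxidealMl => //.
    exact: prime_lies_over.
move=> i; rewrite -(subrK (tofrac (b i)) (a i)).
have [G [H [PG ndvH E]]] := (finite_place_maxidealP irrP _).1 (mb i).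
apply/(finite_place_maxidealP irrP); exists (G + b i * H), H; split=> //.
  by rewrite dvdp_add // dvdp_mulr // free.
have H0 : tofrac H != 0.
  by rewrite tofrac_eq0; apply: contraNneq ndvH => ->; rewrite dvdp0.
by rewrite E rmorphD rmorphM mulrDl mulfK.
Qed.

End PlaceOfPrime.

(** The ideals M i are recovered from their localizations, which are therefore
    distinct.  If the maximal ideal of a place O above P contained none of them, a
    product of elements of the M i would avoid it although a power of that product
    is a multiple of P. *)
Lemma signature_of_decomposition (R : set F) (s : seq (nat *l nat)) :
  sorted <=%O s -> polynomial_order (poly_emb F) R ->
  (forall O, valuation_ring O -> (forall p, O (iota p)) -> R `<=` O) ->
  prime_decomposition P (poly_emb F) R s -> signature F P s.
Proof.
move=> ss ordR intR [M [regM sep rad]]; split=> //.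
exists (fun i => localization R (M i)); split.
- move=> i j /= Eij; apply/eqP; apply: contraT => /sep[z [Mi nMj]]; case: nMj.
  apply: (maxideal_localizationI (prime_maximal (regM j))).
    exact: (ideal_sub (prime_maximal (regM i))).
  rewrite -Eij.
  exact: (sub_maxideal_localization (order_subring ordR) (prime_maximal (regM i))).
- apply/seteqP; split=> [_ [i _ <-]|O [placeO overO]].
    by split; [exact: (prime_place ordR (regM i)) | exact: (prime_lies_over ordR (regM i))].
  have valO := place_valuation_ring placeO.
  have sRO := intR O valO (place_above_poly valO overO).
  have [[i sMi]|nex] := pselect (exists i, M i `<=` maxideal O).
    exists i => //; apply: place_above_eq => //; first exact: (prime_maximal (regM i)).
    exact: (prime_valuation_ring irrP poly_emb_eq0 ordR (regM i)).
  have /fin_all_exists[z zP] i : exists z, M i z /\ ~ maxideal O z.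
    apply: contrapT => nz; apply: nex; exists i => z Mz.
    by apply: contrapT => nmz; apply: nz; exists z.
  have Rz i : R (z i) by apply: (ideal_sub (prime_maximal (regM i))); case: (zP i).
  have Mprod i : M i (\prod_j z j).
    rewrite (bigD1 i) //= mulrC; apply: (idealMl (prime_maximal (regM i))).
      apply: (big_ind R) => [|x y Rx Ry|j _] //; first exact: subring1 (order_subring ordR).
      exact: (subringM (order_subring ordR)).
    by case: (zP i).
  have [n [w [Rw E]]] := rad _ Mprod.
  have: O (\prod_j z j) /\ ~ maxideal O (\prod_j z j).
    apply: (big_ind (fun x => O x /\ ~ maxideal O x)) => [|x y [Ox nx] [Oy ny]|j _].
    - by split; [apply: subring1 valO.1 | apply: maxideal_not1].
    - split; first exact: (subringM valO.1).
      by case/(maxideal_prime valO Ox Oy).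
    - by split; [apply: sRO | case: (zP j)].
  case=> Oprod; case; apply: (maxidealX valO Oprod (n := n)).
  rewrite E mulrC; apply: (maxidealMl valO); first exact: sRO.
  exact: place_above_max.
- move=> i; have := regM i; case: (tnth _ i) => e f /= reg.
  by split; [exact: (prime_ramification ordR reg) | exact: (prime_relative_degree ordR reg)].
Qed.

End PlacesAbove.

(** * The cubic order generated by y and its residue maps *)

Lemma map_cubic (R S : nzRingType) (g : {rmorphism R -> S}) (A B : R) :
  map_poly g (cubic A B) = cubic (g A) (g B).
Proof. by rewrite /cubic rmorphD rmorphB /= map_polyXn map_polyZ map_polyX map_polyC. Qed.

Lemma size_cubic (R : nzRingType) (A B : R) : size (cubic A B) = 4%N.
Proof.
rewrite /cubic -addrA size_polyDl size_polyXn //.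
rewrite (leq_ltn_trans (size_polyD _ _)) // gtn_max size_polyN.
rewrite (leq_ltn_trans (size_scale_leq _ _)) ?size_polyX //=.
by rewrite (leq_ltn_trans (size_polyC_leq1 _)).
Qed.

Lemma horner_cubic (R : comNzRingType) (A B x : R) :
  (cubic A B).[x] = x ^+ 3 - A * x + B.
Proof. by rewrite /cubic !hornerE. Qed.

Lemma horner_size3 (R : nzRingType) (p : {poly R}) (x : R) :
  (size p <= 3)%N -> p.[x] = p`_0 + p`_1 * x + p`_2 * x ^+ 2.
Proof.
by move=> /horner_coef_wide ->; rewrite !big_ord_recl big_ord0 /= mulr1 expr1 addr0 addrA.
Qed.

(** The multiplication table of the cubic ring with basis 1, eta, th.  It governs
    both the order and its residue rings. *)
Lemma cubic_ring_mul (S : comNzRingType) (c a b eta th u v w u' v' w' : S) :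
  eta ^+ 2 = c * th -> eta * th = a * eta - c * b -> th ^+ 2 = a * th - b * eta ->
  (u + v * eta + w * th) * (u' + v' * eta + w' * th) =
  (u * u' - (v * w' + w * v') * (c * b)) +
  (u * v' + v * u' + (v * w' + w * v') * a - w * w' * b) * eta +
  (u * w' + w * u' + v * v' * c + w * w' * a) * th.
Proof.
move=> E1 E2 E3.
transitivity (u * u' + (u * v' + v * u') * eta + (u * w' + w * u') * th
  + v * v' * eta ^+ 2 + (v * w' + w * v') * (eta * th) + w * w' * th ^+ 2).
  by ring.
by rewrite E1 E2 E3; ring.
Qed.

(** What the decomposition of P uses of a cubic function field: 1, y, y^2 are
    independent over k[x] and span the field up to denominators in k[x]. *)
Record cubic_basis (k : fieldType) (L : fieldType) (iota : {rmorphism {poly k} -> L})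
    (A B : {poly k}) (y : L) : Prop := {
  cubic_emb_eq0 : forall p, (iota p == 0) = (p == 0);
  cubic_root : y ^+ 3 = iota A * y - iota B;
  cubic_free : forall u v w, iota u + iota v * y + iota w * y ^+ 2 = 0 ->
    [/\ u = 0, v = 0 & w = 0];
  cubic_span : forall z, exists d u v w,
    d != 0 /\ iota d * z = iota u + iota v * y + iota w * y ^+ 2
}.

Section CubicOrder.
Variables (k : finFieldType) (L : fieldType) (iota : {rmorphism {poly k} -> L}).
Variables (A B : {poly k}) (y : L) (HC : cubic_basis iota A B y).
Variables (c a b : {poly k}).
Hypotheses (c0 : c != 0) (Aca : A = c * a) (Bcb : B = c ^+ 2 * b).

Definition theta : L := y ^+ 2 / iota c.
Let ic0 : iota c != 0. Proof. by rewrite (cubic_emb_eq0 HC). Qed.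

Definition order_elt (u v w : {poly k}) : L := iota u + iota v * y + iota w * theta.

Lemma sqr_y : y ^+ 2 = iota c * theta.
Proof. by rewrite /theta mulrC divfK. Qed.

Lemma y_theta : y * theta = iota a * y - iota (c * b).
Proof.
apply: (mulfI ic0); rewrite mulrCA -sqr_y -exprS (cubic_root HC) Aca Bcb.
by rewrite !rmorphM; ring.
Qed.

Lemma sqr_theta : theta ^+ 2 = iota a * theta - iota b * y.
Proof.
apply: (mulfI ic0); rewrite expr2 mulrA -sqr_y expr2 -mulrA y_theta.
rewrite mulrBr mulrCA -expr2 sqr_y rmorphM; ring.
Qed.

Lemma order_elt_mul u v w u' v' w' : order_elt u v w * order_elt u' v' w' =
  order_elt (u * u' - (v * w' + w * v') * (c * b))
     (u * v' + v * u' + (v * w' + w * v') * a - w * w' * b)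
     (u * w' + w * u' + v * v' * c + w * w' * a).
Proof.
rewrite /order_elt !(rmorphB, rmorphD, rmorphM).
apply: cubic_ring_mul; last exact: sqr_theta.
  exact: sqr_y.
by rewrite y_theta rmorphM.
Qed.

Lemma order_eltB u v w u' v' w' :
  order_elt u v w - order_elt u' v' w' = order_elt (u - u') (v - v') (w - w').
Proof. by rewrite /order_elt !rmorphB; ring. Qed.

Lemma order_elt_poly p : order_elt p 0 0 = iota p.
Proof. by rewrite /order_elt rmorph0 !mul0r !addr0. Qed.

Lemma order_elt_eq0 u v w : order_elt u v w = 0 -> [/\ u = 0, v = 0 & w = 0].
Proof.
move=> E; have : iota (c * u) + iota (c * v) * y + iota w * y ^+ 2 = 0.
  transitivity (iota c * order_elt u v w); last by rewrite E mulr0.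
  by rewrite sqr_y /order_elt !rmorphM; ring.
by case/(cubic_free HC) => /eqP + /eqP + ->; rewrite !mulf_eq0 !(negPf c0) => /eqP -> /eqP ->.
Qed.

Lemma order_elt_inj u v w u' v' w' : order_elt u v w = order_elt u' v' w' ->
  [/\ u = u', v = v' & w = w'].
Proof.
move/eqP; rewrite -subr_eq0 order_eltB => /eqP/order_elt_eq0[] /eqP + /eqP + /eqP.
by rewrite !subr_eq0 => /eqP -> /eqP -> /eqP ->.
Qed.

Definition cubic_order : set L := [set z | exists u v w, z = order_elt u v w].
Local Notation R := cubic_order.

Lemma cubic_order_subring : subring R.
Proof.
split.
- by exists 1, 0, 0; rewrite order_elt_poly rmorph1.
- by move=> _ _ [u [v [w ->]]] [u' [v' [w' ->]]]; rewrite order_eltB; do 3!eexists.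
- by move=> _ _ [u [v [w ->]]] [u' [v' [w' ->]]]; rewrite order_elt_mul; do 3!eexists.
Qed.

Lemma quadratic_integral_mem (O : set L) (z r s : L) : valuation_ring O ->
  O r -> O s -> z ^+ 2 = r * z + s -> O z.
Proof.
move=> valO Or Os E; apply: contrapT => nOz; apply: nOz.
have [//|Ozi] := valO.2 z; have subO := valO.1.
have [->|z0] := eqVneq z 0; first exact: subring0.
have -> : z = r + s * z^-1.
  by apply: (mulIf z0); rewrite -expr2 E mulrDl divfK.
by apply: subringD => //; apply: subringM.
Qed.

Lemma cubic_order_polynomial : polynomial_order iota R.
Proof.
split.
- exact: cubic_order_subring.
- by move=> p; exists p, 0, 0; rewrite order_elt_poly.
- move=> z; have [d [u [v [w [d0 E]]]]] := cubic_span HC z.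
  exists d => //; exists u, v, (w * c).
  by rewrite E sqr_y /order_elt rmorphM; ring.
Qed.

Lemma cubic_order_integral (O : set L) : valuation_ring O ->
  (forall p, O (iota p)) -> R `<=` O.
Proof.
move=> valO Op _ [u [v [w ->]]]; have subO := valO.1.
have Oy : O y.
  have [//|Oyi] := valO.2 y.
  have [->|y0] := eqVneq y 0; first exact: subring0.
  have -> : y = iota A * y^-1 - iota B * (y^-1 * y^-1).
    apply: (mulIf (mulf_neq0 y0 y0)); rewrite -[LHS]/(y ^+ 3) (cubic_root HC).
    by field.
  by apply: (subringB subO); do !apply: (subringM subO).
have Ot : O theta.
  apply: (quadratic_integral_mem valO (r := iota a) (s := - (iota b * y))) => //.
    by apply: subringN => //; apply: subringM.
  exact: sqr_theta.
by do !apply: (subringD subO) => //; apply: (subringM subO).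
Qed.

Variable P : {poly k}.

Section ResidueMap.
Variables (kappa : finFieldType) (phi : {rmorphism {poly k} -> kappa}).
Variables (eta vth : kappa).

(** The relations between y and theta, transported to the finite field kappa by
    y |-> eta and theta |-> vth; phi is reduction modulo P on k[x]. *)
Definition residue_compatible : Prop :=
  [/\ forall p, (phi p == 0) = (P %| p), eta ^+ 2 = phi c * vth,
      eta * vth = phi a * eta - phi (c * b) & vth ^+ 2 = phi a * vth - phi b * eta].

Definition residue_value (u v w : {poly k}) : kappa := phi u + phi v * eta + phi w * vth.

Definition residue_kernel : set L :=
  [set z | exists u v w, z = order_elt u v w /\ residue_value u v w = 0].
Local Notation M := residue_kernel.

Lemma residue_kernelP u v w : M (order_elt u v w) <-> residue_value u v w = 0.
Proof.
by split=> [[u' [v' [w' [/order_elt_inj[-> -> ->]]]]] // | E]; exists u, v, w.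
Qed.

Hypothesis compat : residue_compatible.

Lemma residue_valueM u v w u' v' w' : residue_value u v w * residue_value u' v' w' =
  residue_value (u * u' - (v * w' + w * v') * (c * b))
      (u * v' + v * u' + (v * w' + w * v') * a - w * w' * b)
      (u * w' + w * u' + v * v' * c + w * w' * a).
Proof.
have [_ E1 E2 E3] := compat.
by rewrite /residue_value !(rmorphB, rmorphD, rmorphM) in E2 *; apply: cubic_ring_mul.
Qed.

Lemma residue_valueB u v w u' v' w' :
  residue_value u v w - residue_value u' v' w' =
  residue_value (u - u') (v - v') (w - w').
Proof. by rewrite /residue_value !rmorphB; ring. Qed.

Lemma residue_value_poly p : residue_value p 0 0 = phi p.
Proof. by rewrite /residue_value rmorph0 !mul0r !addr0. Qed.

Lemma order_elt_exp u v w n : exists u' v' w',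
  order_elt u v w ^+ n = order_elt u' v' w' /\
  residue_value u v w ^+ n = residue_value u' v' w'.
Proof.
elim: n => [|n [u' [v' [w' [E E']]]]].
  by exists 1, 0, 0; rewrite order_elt_poly residue_value_poly !rmorph1.
by rewrite !exprS E E' order_elt_mul residue_valueM; do 3!eexists.
Qed.

(** The image of R in the finite field is closed under powers, so the inverse of a
    nonzero element of the image is again in the image. *)
Lemma residue_kernel_maximal : maximal_ideal R M.
Proof.
split.
- by move=> _ [u [v [w [-> _]]]]; exists u, v, w.
- by exists 0, 0, 0; rewrite order_elt_poly residue_value_poly !rmorph0.
- move=> _ _ [u [v [w [-> E]]]] [u' [v' [w' [-> E']]]]; rewrite order_eltB.
  by apply/residue_kernelP; rewrite -residue_valueB E E' subrr.
- move=> _ _ [u [v [w ->]]] [u' [v' [w' [-> E']]]]; rewrite order_elt_mul.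
  by apply/residue_kernelP; rewrite -residue_valueM E' mulr0.
have one : order_elt 1 0 0 = 1 by rewrite order_elt_poly rmorph1.
split.
  by rewrite -one => /residue_kernelP/eqP; rewrite residue_value_poly rmorph1 oner_eq0.
move=> _ [u [v [w ->]]] /residue_kernelP/eqP res0.
have [N NE] : exists N, #|kappa| = N.+2.
  by case: #|kappa| (finNzRing_gt1 kappa) => [|[|N]] // _; exists N.
(* In a field with N + 2 elements the inverse of x is x^N. *)
exists (order_elt u v w ^+ N).
  by have [u' [v' [w' [-> _]]]] := order_elt_exp u v w N; exists u', v', w'.
rewrite -exprS; have [u' [v' [w' [-> E]]]] := order_elt_exp u v w N.+1.
rewrite -one order_eltB; apply/residue_kernelP.
rewrite -residue_valueB -E residue_value_poly rmorph1.
apply: (mulfI res0); rewrite mulr0 mulrBr mulr1 -exprS.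
by rewrite -NE expf_card subrr.
Qed.

Lemma residue_kernel_above : M (iota P).
Proof.
have [ker _ _ _] := compat; rewrite -order_elt_poly; apply/residue_kernelP.
by rewrite residue_value_poly; apply/eqP; rewrite ker dvdpp.
Qed.

(** R / M is isomorphic to the image of R in kappa, so a basis can be checked
    there. *)
Lemma residue_degree_basis (n : nat) (U V W : 'I_n -> {poly k}) :
  (forall u v w, exists x : 'I_n -> {poly k},
     residue_value u v w = \sum_i phi (x i) * residue_value (U i) (V i) (W i)) ->
  (forall x : 'I_n -> {poly k}, \sum_i phi (x i) * residue_value (U i) (V i) (W i) = 0 ->
     forall i, phi (x i) = 0) ->
  residue_degree P iota R M n.
Proof.
have [ker _ _ _] := compat => span free.
have elsum (x : 'I_n -> {poly k}) : \sum_i iota (x i) * order_elt (U i) (V i) (W i) =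
    order_elt (\sum_i x i * U i) (\sum_i x i * V i) (\sum_i x i * W i).
  rewrite /order_elt !rmorph_sum /= !mulr_suml -!big_split /=.
  by apply: eq_bigr => i _; rewrite !rmorphM; ring.
have ressum (x : 'I_n -> {poly k}) : \sum_i phi (x i) * residue_value (U i) (V i) (W i) =
    residue_value (\sum_i x i * U i) (\sum_i x i * V i) (\sum_i x i * W i).
  rewrite /residue_value !rmorph_sum /= !mulr_suml -!big_split /=.
  by apply: eq_bigr => i _; rewrite !rmorphM; ring.
exists (fun i => order_elt (U i) (V i) (W i)); split=> [i|_ [u [v [w ->]]]|x].
- by exists (U i), (V i), (W i).
- have [x E] := span u v w; exists x; rewrite elsum order_eltB; apply/residue_kernelP.
  by rewrite -residue_valueB E ressum subrr.
- rewrite elsum => /residue_kernelP; rewrite -ressum => /free x0 i.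
  by rewrite -ker x0.
Qed.

Lemma residue_degree1 : (forall x, exists p, phi p = x) -> residue_degree P iota R M 1.
Proof.
move=> surj; apply: (@residue_degree_basis 1 (fun=> 1) (fun=> 0) (fun=> 0)).
  move=> u v w; have [p E] := surj (residue_value u v w).
  by exists (fun=> p); rewrite big_ord1 residue_value_poly rmorph1 mulr1 E.
by move=> x; rewrite big_ord1 residue_value_poly rmorph1 mulr1 => x0 i; rewrite ord1.
Qed.

End ResidueMap.

End CubicOrder.

(** * The basis 1, y, y^2 of a cubic function field *)

Section CubicFunctionField.
Variables (k : finFieldType) (F : fieldExtType {fraction {poly k}}).
Variables (A B : {poly k}) (y : F) (HF : cubic_standard_form A B y).
Local Notation K := {fraction {poly k}}.
Local Notation iota := (@poly_emb k F).

Let f : {poly K} := map_poly (@tofrac {poly k}) (cubic A B).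

Lemma root_f : (map_poly (in_alg F) f).[y] = 0.
Proof.
rewrite /f map_cubic map_cubic; apply/eqP; exact: csf_root HF.
Qed.

(** The cubic is irreducible, hence coprime to any nonzero polynomial of degree at
    most 2. *)
Lemma degree_lt3_free (p : {poly K}) : (size p <= 3)%N ->
  (map_poly (in_alg F) p).[y] = 0 -> p = 0.
Proof.
move=> szp py; apply/eqP; apply: contraT => p0.
have irrf : irreducible_poly f := csf_irreducible HF.
have /Bezout_eq1_coprimepP[[u v] /= E] : coprimep f p.
  rewrite irreducible_poly_coprime //; apply/negP => /(dvdp_leq p0).
  by rewrite /f map_cubic size_cubic leqNgt ltnS szp.
have := congr1 (fun q => (map_poly (in_alg F) q).[y]) E.
rewrite rmorphD !rmorphM rmorph1 /= !hornerE py root_f !mulr0 addr0.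
by move/esym/eqP; rewrite oner_eq0.
Qed.

Lemma coordinates z : exists p0 p1 p2 : K, z = p0%:A + p1%:A * y + p2%:A * y ^+ 2.
Proof.
have /Fadjoin_polyP[_ /polyOver1P[q ->] ->] : z \in <<1; y>>%VS.
  by rewrite (csf_generated HF) memvf.
have f0 : f != 0 by rewrite -size_poly_gt0 /f map_cubic size_cubic.
rewrite (divp_eq q f) rmorphD rmorphM /= hornerD hornerM root_f mulr0 add0r.
exists (q %% f)`_0, (q %% f)`_1, (q %% f)`_2.
rewrite (horner_size3 (p := map_poly _ _)) ?coef_map //.
rewrite size_map_poly -ltnS.
by have := ltn_modp q f; rewrite f0 /f map_cubic size_cubic.
Qed.

Lemma cubic_standard_basis : cubic_basis (poly_emb F) A B y.
Proof.
split.
- exact: poly_emb_eq0.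
- have := csf_root HF; rewrite rootE horner_cubic -!poly_embE => /eqP E.
  by apply/eqP; rewrite -subr_eq0 -[X in _ == X]E; apply/eqP; ring.
- move=> u v w E; pose p : {poly K} := Poly [:: tofrac u; tofrac v; tofrac w].
  have szp : (size p <= 3)%N by apply: size_Poly.
  have /(degree_lt3_free szp) p0 : (map_poly (in_alg F) p).[y] = 0.
    by rewrite horner_size3 ?size_map_poly // !coef_map !coef_Poly /= -!poly_embE.
  have coef0 i : p`_i = 0 by rewrite p0 coef0.
  have eq0 (q : {poly k}) : tofrac q = 0 -> q = 0.
    by move/eqP; rewrite tofrac_eq0 => /eqP.
  split; apply: eq0.
  + by have := coef0 0%N; rewrite coef_Poly.
  + by have := coef0 1%N; rewrite coef_Poly.
  + by have := coef0 2%N; rewrite coef_Poly.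
- move=> z; have [p0 [p1 [p2 ->]]] := coordinates z.
  have [n0 [d0 [d00 ->]]] := frac_numden p0.
  have [n1 [d1 [d10 ->]]] := frac_numden p1.
  have [n2 [d2 [d20 ->]]] := frac_numden p2.
  exists (d0 * d1 * d2), (n0 * d1 * d2), (n1 * d0 * d2), (n2 * d0 * d1).
  split; first by rewrite !mulf_neq0.
  rewrite !poly_emb_frac !rmorphM.
  by field; rewrite !poly_emb_eq0 d00 d10 d20.
Qed.

End CubicFunctionField.

(** * Decomposition of P in the cubic order *)

(** The quotient kappa[T] / (g) is such a field, with eta the class of T. *)
Lemma finite_extension (kappa : finFieldType) (g : {poly kappa}) :
  monic_irreducible_poly g ->
  exists (kappa' : finFieldType) (psi : {rmorphism kappa -> kappa'}) (eta : kappa'),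
    forall q, ((map_poly psi q).[eta] == 0) = (g %| q).
Proof.
move=> hg; pose psi : {rmorphism kappa -> {poly %/ g with hg}} := qpolyC g.
exists ({poly %/ g with hg} : finFieldType), psi, (in_qpoly g 'X) => q.
rewrite -(in_qpoly_eq0 hg); congr (_ == _).
have inC x : in_qpoly g x%:P = psi x.
  apply: val_inj; apply: in_qpoly_small.
  by apply: leq_ltn_trans (size_polyC_leq1 _) (size_mk_monic_gt1 _).
elim/poly_ind: q => [|q x IHq]; first by rewrite rmorph0 horner0 rmorph0.
by rewrite !rmorphD !rmorphM /= map_polyX map_polyC !hornerE IHq inC.
Qed.

Section Cases.
Variables (k : finFieldType) (L : fieldType) (iota : {rmorphism {poly k} -> L}).
Variables (A B : {poly k}) (y : L) (HC : cubic_basis iota A B y).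
Variables (P : {poly k}) (hP : monic_irreducible_poly P).
Let kappa := ({poly %/ P with hP} : finFieldType).
Let rho : {rmorphism {poly k} -> kappa} := in_qpoly P.

Lemma rho_eq0 p : (rho p == 0) = (P %| p).
Proof. exact: in_qpoly_eq0. Qed.

Lemma rho_surj (x : kappa) : exists p, rho p = x.
Proof.
by exists (val x); apply: val_inj; apply: in_qpoly_small (size_mk_monic _).
Qed.

Let P0 : P != 0. Proof. by rewrite -size_poly_gt0 ltnW // hP.1.1. Qed.

Section Ramified.
Variables (c a b : {poly k}).
Hypotheses (c0 : c != 0) (Aca : A = c * a) (Bcb : B = c ^+ 2 * b).
Local Notation R := (cubic_order iota y c).
Local Notation theta := (theta iota y c).
Local Notation el := (order_elt iota y c).
Let subR : subring R := cubic_order_subring HC c0 Aca Bcb.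
Let Rp p : R (iota p). Proof. by exists p, 0, 0; rewrite order_elt_poly. Qed.
Let elE u v w : el u v w = iota u + iota v * y + iota w * theta. Proof. by []. Qed.
Let Ry : R y.
Proof. by exists 0, 1, 0; rewrite elE rmorph0 rmorph1; ring. Qed.
Let Rt : R theta.
Proof. by exists 0, 0, 1; rewrite elE rmorph0 rmorph1; ring. Qed.
Let Rn n : R n%:R. Proof. by rewrite -(rmorph_nat iota); apply: Rp. Qed.
Let Rel u v w : R (el u v w). Proof. by exists u, v, w. Qed.

Local Ltac inR := do ?[exact: Rn | exact: Rp | exact: Ry | exact: Rt | exact: Rel
  | exact: (subring1 subR) | apply: (subringX subR) | apply: (subringB subR)
  | apply: (subringN subR) | apply: (subringD subR) | apply: (subringM subR)].

(** The two primes correspond to the solutions theta = 0 and theta = a, with y = 0,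
    of the relations modulo P.  At the first one theta - a is a local unit and
    multiplies y and theta into P R, up to one more factor; at the second one theta
    is a local unit and y^2 = P theta. *)
Lemma decomposition_partially_ramified : c = P -> ~~ (P %| a) ->
  prime_decomposition P iota R [:: (1, 1); (2, 1)]%N.
Proof.
move=> cP nPa; have ra0 : rho a != 0 by rewrite rho_eq0.
have rc0 : rho c = 0 by apply/eqP; rewrite rho_eq0 cP.
have compat1 : residue_compatible c a b P rho 0 0.
  split; first exact: rho_eq0.
  - by rewrite rc0; ring.
  - by rewrite rmorphM rc0; ring.
  - by ring.
have compat2 : residue_compatible c a b P rho 0 (rho a).
  split; first exact: rho_eq0.
  - by rewrite rc0; ring.
  - by rewrite rmorphM rc0; ring.
  - by ring.
pose M1 : set L := residue_kernel iota y c rho 0 0.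
pose M2 : set L := residue_kernel iota y c rho 0 (rho a).
have M1P u v w : M1 (el u v w) <-> rho u = 0.
  by rewrite /M1 (residue_kernelP HC c0) /residue_value !mulr0 !addr0.
have M2P u v w : M2 (el u v w) <-> rho (u + w * a) = 0.
  by rewrite /M2 (residue_kernelP HC c0) /residue_value rmorphD rmorphM mulr0 addr0.
have max1 : maximal_ideal R M1 := residue_kernel_maximal HC c0 Aca Bcb compat1.
have max2 : maximal_ideal R M2 := residue_kernel_maximal HC c0 Aca Bcb compat2.
have Eyy := sqr_y HC c0; have Eyt := y_theta HC c0 Aca Bcb.
have Ett := sqr_theta HC c0 Aca Bcb.
have div p : rho p = 0 -> exists q, p = q * P.
  by move/eqP; rewrite rho_eq0 => /dvdpP.
(* The sorted signature lists the unramified prime first. *)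
pose M (i : 'I_2) : set L := if val i == 0%N then M1 else M2.
exists M; split=> //.
- have reg1 : regular_prime P iota R M1 1 1.
    split=> //; first exact: (residue_kernel_above HC c0 compat1).
      exists (iota P); split; last first.
        exists 1, 1; rewrite expr1; split=> //; try exact: (subring1 subR);
        exact: (ideal_not1 max1).
      split; first exact: (residue_kernel_above HC c0 compat1).
      move=> z Mz; have [u [v [w zE]]] := ideal_sub max1 Mz.
      move: Mz; rewrite zE => /M1P/div[u' uE]; pose s := el (- a) 0 1.
      have nMs : ~ M1 s by move/M1P/eqP; rewrite rmorphN oppr_eq0 (negPf ra0).
      have sE : s = theta - iota a.
        by rewrite /s elE rmorphN rmorph0 rmorph1; ring.
      (* One factor s kills y modulo P; theta needs two, since s theta = - b y. *)
      exists (s ^+ 2), (s ^+ 2 * iota u' - iota v * iota b * s + iota w * iota b ^+ 2).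
      split; [by inR | exact: (notinX subR max1 (Rel _ _ _) nMs) | by inR |].
      have Es1 : s * y = - (iota P * iota b).
        by rewrite sE mulrBl [theta * y]mulrC Eyt cP rmorphM; ring.
      have Es2 : s * theta = - (iota b * y).
        by rewrite sE mulrBl -expr2 Ett; ring.
      rewrite elE uE rmorphM.
      transitivity (iota P * (s ^+ 2 * iota u') + iota v * s * (s * y) +
        iota w * s * (s * theta)); first by ring.
      rewrite Es2 Es1; transitivity (iota P * (s ^+ 2 * iota u' - iota v * iota b * s) -
        iota w * iota b * (s * y)); first by ring.
      by rewrite Es1; ring.
    exact: (residue_degree1 HC c0 compat1 rho_surj).
  have reg2 : regular_prime P iota R M2 2 1.
    split=> //; first exact: (residue_kernel_above HC c0 compat2).
      have nMt : ~ M2 theta.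
        have -> : theta = el 0 0 1 by rewrite elE rmorph0 rmorph1; ring.
        by move/M2P/eqP; rewrite add0r mul1r (negPf ra0).
      exists y; split; last first.
        exists theta, 1; split; [exact: Rt | exact: nMt | exact: (subring1 subR) |
          exact: (ideal_not1 max2) | by rewrite mulr1 Eyy cP].
      split; first by have -> : y = el 0 1 0;
        [rewrite elE rmorph0 rmorph1; ring | apply/M2P; rewrite mul0r addr0 rmorph0].
      move=> z Mz; have [u [v [w zE]]] := ideal_sub max2 Mz.
      move: Mz; rewrite zE => /M2P/div[u' /(canRL (addrK _)) uE].
      exists theta, (iota u' * y + iota v * theta - iota w * iota b).
      split; [exact: Rt | exact: nMt | by inR |].
      rewrite elE uE rmorphB !rmorphM.
      transitivity (iota u' * (iota P * theta) + iota v * (y * theta) +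
         iota w * (theta ^+ 2 - iota a * theta)); first by ring.
      by rewrite Ett -cP -Eyy; ring.
    exact: (residue_degree1 HC c0 compat2 rho_surj).
  by case=> [[|[|i]] Hi].
- have M12 : M1 theta /\ ~ M2 theta.
    have -> : theta = el 0 0 1 by rewrite elE rmorph0 rmorph1; ring.
    split; first by apply/M1P; rewrite rmorph0.
    by move/M2P/eqP; rewrite add0r mul1r (negPf ra0).
  have M21 : M2 (el (- a) 0 1) /\ ~ M1 (el (- a) 0 1).
    split; first by apply/M2P; rewrite mul1r addNr rmorph0.
    by move/M1P/eqP; rewrite rmorphN oppr_eq0 (negPf ra0).
  by case=> [[|[|i]] Hi] [[|[|j]] Hj] // _; rewrite /M /=; eexists; eassumption.
- move=> z Mz; have Mz1 : M1 z := Mz ord0; have Mz2 : M2 z := Mz ord_max.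
  have [u [v [w zE]]] := ideal_sub max1 Mz1.
  move: Mz1 Mz2; rewrite zE => /M1P u0 /M2P/eqP; rewrite rmorphD u0 add0r rmorphM.
  rewrite mulf_eq0 (negPf ra0) orbF => /eqP/div[w' wE].
  have [u' uE] := div u u0; pose x := iota u' + iota w' * theta.
  (* Modulo P the element is v y, and y^2 = P theta. *)
  exists 2%N, (iota P * x ^+ 2 + 2%:R * x * iota v * y + iota v ^+ 2 * theta).
  split.
    by rewrite /x; inR.
  rewrite elE uE wE !rmorphM; transitivity (iota P * (iota P * x ^+ 2 + 2%:R * x * iota v * y)
     + iota v ^+ 2 * y ^+ 2); first by rewrite /x; ring.
  by rewrite Eyy cP; ring.
Qed.

(** The only solution of the relations modulo P is y = theta = 0. *)
Lemma decomposition_totally_ramified (M := residue_kernel iota y c rho 0 0) :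
  residue_compatible c a b P rho 0 0 ->
  (exists t, locally_generates R M t /\
     exists s u, [/\ R s, ~ M s, R u, ~ M u & iota P * s = t ^+ 3 * u]) ->
  (forall z, M z -> exists n w, R w /\ z ^+ n = iota P * w) ->
  prime_decomposition P iota R [:: (3, 1)]%N.
Proof.
move=> compat unif nil.
exists (fun=> M); split=> //.
- move=> i; rewrite ord1; split=> //.
  + exact: (residue_kernel_maximal HC c0 Aca Bcb compat).
  + exact: (residue_kernel_above HC c0 compat).
  + exact: (residue_degree1 HC c0 compat rho_surj).
- by move=> i j; rewrite !ord1.
- by move=> z Mz; apply: nil; apply: Mz ord0.
Qed.

(** Here y^3 = A y - B = - P (b' - a' y), and b' - a' y is a local unit. *)
Lemma decomposition_totally_ramified_val1 a' b' : c = 1 -> a = a' * P -> b = b' * P ->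
  ~~ (P %| b') -> prime_decomposition P iota R [:: (3, 1)]%N.
Proof.
move=> c1 aE bE nPb.
have ra0 : rho a = 0 by apply/eqP; rewrite rho_eq0 aE dvdp_mull.
have rb0 : rho b = 0 by apply/eqP; rewrite rho_eq0 bE dvdp_mull.
have compat : residue_compatible c a b P rho 0 0.
  split; first exact: rho_eq0.
  - by ring.
  - by rewrite rmorphM rb0; ring.
  - by ring.
set M := residue_kernel iota y c rho 0 0.
have MP u v w : M (el u v w) <-> rho u = 0.
  by rewrite /M (residue_kernelP HC c0) /residue_value !mulr0 !addr0.
have maxM : maximal_ideal R M := residue_kernel_maximal HC c0 Aca Bcb compat.
have thE : theta = y ^+ 2 by rewrite [RHS](sqr_y HC c0) c1 rmorph1 mul1r.
pose s := el b' (- a') 0.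
have nMs : ~ M s by move/MP/eqP; rewrite rho_eq0 (negPf nPb).
have Rs : R s by inR.
have y3 : y ^+ 3 = - (iota P * s).
  have -> : y ^+ 3 = y * theta by rewrite thE; ring.
  rewrite (y_theta HC c0 Aca Bcb) /s elE aE bE c1 !rmorphM rmorph1 rmorph0 rmorphN.
  by ring.
have My : M y.
  have -> : y = el 0 1 0 by rewrite elE rmorph0 rmorph1; ring.
  by apply/MP; rewrite rmorph0.
apply: (decomposition_totally_ramified compat).
  exists y; split; last first.
    exists s, (- 1); split=> //; first by inR.
      by move/(idealN maxM); rewrite opprK; apply: ideal_not1 maxM.
    by rewrite y3; ring.
  split; first exact: My.
  move=> z Mz; have [u [v [w zE]]] := ideal_sub maxM Mz.
  move: Mz; rewrite zE => /MP/eqP; rewrite rho_eq0 => /dvdpP[u' uE].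
  exists s, (s * iota v + s * iota w * y - y ^+ 2 * iota u'); split=> //; first by inR.
  rewrite elE uE rmorphM thE.
  transitivity (iota u' * (iota P * s) + s * iota v * y + s * iota w * y ^+ 2).
    by ring.
  by rewrite -[iota P * s]opprK -y3; ring.
move=> z Mz; have [u [v [w zE]]] := ideal_sub maxM Mz.
move: Mz; rewrite zE => /MP/eqP; rewrite rho_eq0 => /dvdpP[u' uE].
pose p := iota u'; pose x := iota v + iota w * y.
exists 3%N, (iota P ^+ 2 * p ^+ 3 + 3%:R * iota P * p ^+ 2 * y * x
  + 3%:R * p * y ^+ 2 * x ^+ 2 - s * x ^+ 3); split.
  by rewrite /p /x; inR.
rewrite elE uE rmorphM thE.
transitivity (iota P * (iota P ^+ 2 * p ^+ 3 + 3%:R * iota P * p ^+ 2 * y * x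
  + 3%:R * p * y ^+ 2 * x ^+ 2) + y ^+ 3 * x ^+ 3); first by rewrite /x /p; ring.
by rewrite y3; ring.
Qed.

(** With s = a' y - b, a local unit, the relations read y^2 = P theta,
    y theta = P s and b y = theta (P a' - theta); they give theta^3 = P s^2. *)
Lemma decomposition_totally_ramified_val2 a' : c = P -> a = a' * P ->
  ~~ (P %| b) -> prime_decomposition P iota R [:: (3, 1)]%N.
Proof.
move=> cP aE nPb.
have ra0 : rho a = 0 by apply/eqP; rewrite rho_eq0 aE dvdp_mull.
have rc0 : rho c = 0 by apply/eqP; rewrite rho_eq0 cP.
have compat : residue_compatible c a b P rho 0 0.
  split; first exact: rho_eq0.
  - by ring.
  - by rewrite rmorphM rc0; ring.
  - by ring.
set M := residue_kernel iota y c rho 0 0.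
have MP u v w : M (el u v w) <-> rho u = 0.
  by rewrite /M (residue_kernelP HC c0) /residue_value !mulr0 !addr0.
have maxM : maximal_ideal R M := residue_kernel_maximal HC c0 Aca Bcb compat.
have Eyy : y ^+ 2 = iota P * theta by rewrite -cP; apply: (sqr_y HC c0).
have Eyt : y * theta = iota P * (iota a' * y - iota b).
  by rewrite (y_theta HC c0 Aca Bcb) aE cP !rmorphM; ring.
have Ett : theta ^+ 2 = iota P * iota a' * theta - iota b * y.
  by rewrite (sqr_theta HC c0 Aca Bcb) aE rmorphM; ring.
pose s := el (- b) a' 0.
have sE : s = iota a' * y - iota b by rewrite /s elE rmorphN rmorph0; ring.
have nMs : ~ M s by move/MP/eqP; rewrite rmorphN oppr_eq0 rho_eq0 (negPf nPb).
have Rs : R s by inR.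
have t3 : theta ^+ 3 = iota P * s ^+ 2.
  transitivity (theta * theta ^+ 2); first by ring.
  rewrite Ett; transitivity (iota P * iota a' * theta ^+ 2 - iota b * (y * theta)).
    by ring.
  by rewrite Ett Eyt sE; transitivity (iota a' * iota a' * (iota P * (iota P * theta))
    - iota P * iota b * (2%:R * iota a' * y - iota b)); [|rewrite -Eyy]; ring.
apply: (decomposition_totally_ramified compat).
  exists theta; split; last first.
    exists (s ^+ 2), 1; split; [by inR | exact: (notinX subR maxM Rs nMs) | by inR
      | exact: (ideal_not1 maxM) | by rewrite mulr1 t3].
  split.
    have -> : theta = el 0 0 1 by rewrite elE rmorph0 rmorph1; ring.
    by apply/MP; rewrite rmorph0.
  move=> z Mz; have [u [v [w zE]]] := ideal_sub maxM Mz.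
  move: Mz; rewrite zE => /MP/eqP; rewrite rho_eq0 => /dvdpP[u' uE].
  have nMb : ~ M (iota b).
    by rewrite -(order_elt_poly iota y c) => /MP/eqP; rewrite rho_eq0 (negPf nPb).
  exists (iota b * s), (iota b * y * iota u' + s * iota v * (iota P * iota a' - theta)
    + iota b * s * iota w); split; [by inR | exact: (notinM maxM) | by inR |].
  rewrite elE uE rmorphM.
  transitivity (iota b * iota u' * (iota P * s) + s * iota v * (iota b * y)
    + iota b * s * iota w * theta); first by ring.
  have Eby : iota b * y = theta * (iota P * iota a' - theta).
    by apply/eqP; rewrite -subr_eq0 mulrBr -expr2 Ett; apply/eqP; ring.
  have EPs : iota P * s = y * theta by rewrite sE -Eyt.
  by rewrite [in LHS]Eby EPs; ring.
move=> z Mz; have [u [v [w zE]]] := ideal_sub maxM Mz.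
move: Mz; rewrite zE => /MP/eqP; rewrite rho_eq0 => /dvdpP[u' uE].
pose p := iota u'; pose x := iota v * y + iota w * theta.
exists 3%N, (iota P ^+ 2 * p ^+ 3 + 3%:R * iota P * p ^+ 2 * x + 3%:R * p * x ^+ 2
  + (iota v ^+ 3 * theta * y + 3%:R * iota v ^+ 2 * iota w * theta ^+ 2
     + 3%:R * iota v * iota w ^+ 2 * s * theta + iota w ^+ 3 * s ^+ 2)); split.
  by rewrite /p /x; inR.
rewrite elE uE rmorphM.
transitivity (iota P * (iota P ^+ 2 * p ^+ 3 + 3%:R * iota P * p ^+ 2 * x + 3%:R * p * x ^+ 2)
  + x ^+ 3); first by rewrite /x /p; ring.
have -> : x ^+ 3 = iota v ^+ 3 * y * y ^+ 2 + 3%:R * iota v ^+ 2 * iota w * theta * y ^+ 2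
     + 3%:R * iota v * iota w ^+ 2 * theta * (y * theta) + iota w ^+ 3 * theta ^+ 3.
  by rewrite /x; ring.
by rewrite Eyy Eyt t3 sE; ring.
Qed.

End Ramified.
Section Unramified.
Hypothesis nPA : ~~ (P %| A).
Let A1 : A = 1 * A. Proof. by rewrite mul1r. Qed.
Let B1 : B = 1 ^+ 2 * B. Proof. by rewrite expr1n mul1r. Qed.
Let one0 : (1 : {poly k}) != 0 := oner_neq0 _.
Local Notation R := (cubic_order iota y 1).
Local Notation el := (order_elt iota y 1).
Let fbar : {poly kappa} := cubic (rho A) (rho B).
Let rA0 : rho A != 0. Proof. by rewrite rho_eq0. Qed.

(** With c = 1 an element of the order is a polynomial of degree at most 2 in y;
    this is its reduction modulo P.  Residue maps are evaluations of it at roots of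
    the reduced cubic. *)
Definition residue_poly (u v w : {poly k}) : {poly kappa} :=
  Poly [:: rho u; rho v; rho w].

Lemma size_residue_poly u v w : (size (residue_poly u v w) <= 3)%N.
Proof. exact: size_Poly. Qed.

Lemma residue_poly_eq0 u v w : residue_poly u v w = 0 -> [/\ P %| u, P %| v & P %| w].
Proof.
move=> q0; have q0i i : (residue_poly u v w)`_i = 0 by rewrite q0 coef0.
rewrite -!rho_eq0; split; apply/eqP.
- by have := q0i 0%N; rewrite coef_Poly.
- by have := q0i 1%N; rewrite coef_Poly.
- by have := q0i 2%N; rewrite coef_Poly.
Qed.

Section Point.
Variables (kappa' : finFieldType) (psi : {rmorphism kappa -> kappa'}) (eta : kappa').
Let phi : {rmorphism {poly k} -> kappa'} := psi \o rho.

Lemma residue_value_horner u v w :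
  residue_value phi eta (eta ^+ 2) u v w = (map_poly psi (residue_poly u v w)).[eta].
Proof.
rewrite horner_size3 ?size_map_poly ?size_residue_poly //.
by rewrite !coef_map !coef_Poly.
Qed.

Lemma unramified_compat : (map_poly psi fbar).[eta] = 0 ->
  residue_compatible 1 A B P phi eta (eta ^+ 2).
Proof.
rewrite map_cubic horner_cubic => E.
have eta3 : eta ^+ 3 = phi A * eta - phi B.
  by apply/eqP; rewrite -subr_eq0 -[X in _ == X]E; apply/eqP => /=; ring.
split.
- by move=> p; rewrite /= fmorph_eq0 rho_eq0.
- by rewrite rmorph1 mul1r.
- by rewrite mul1r -eta3; ring.
- transitivity (eta * eta ^+ 3); first by ring.
  by rewrite eta3; ring.
Qed.

End Point.

Lemma residue_poly0_divisible u v w : residue_poly u v w = 0 ->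
  exists z, R z /\ el u v w = iota P * z.
Proof.
case/residue_poly_eq0=> /dvdpP[u' ->] /dvdpP[v' ->] /dvdpP[w' ->].
exists (el u' v' w'); split; first by exists u', v', w'.
by rewrite /order_elt !rmorphM; ring.
Qed.

(** A cubic without roots is irreducible, and no nonzero polynomial of degree at
    most 2 vanishes at a root of it in an extension. *)
Lemma decomposition_inert : (forall r, ~~ root fbar r) ->
  prime_decomposition P iota R [:: (1, 3)]%N.
Proof.
move=> noroot.
have hg : monic_irreducible_poly fbar.
  split; first by apply: cubic_irreducible; rewrite // size_cubic.
  by rewrite monicE lead_coefE size_cubic /cubic !coefE /= mulr0 subr0 addr0.
have [kappa' [psi [eta minp]]] := finite_extension hg.
pose phi : {rmorphism {poly k} -> kappa'} := psi \o rho.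
have compat : residue_compatible 1 A B P phi eta (eta ^+ 2).
  by apply: unramified_compat; apply/eqP; rewrite minp dvdpp.
have free u v w : residue_value phi eta (eta ^+ 2) u v w = 0 -> residue_poly u v w = 0.
  move/eqP; rewrite residue_value_horner minp => dv; apply/eqP; apply: contraT => q0.
  have := dvdp_leq q0 dv; rewrite size_cubic => le4.
  by have := leq_trans le4 (size_residue_poly u v w).
set M := residue_kernel iota y 1 phi eta (eta ^+ 2).
apply: (@unramified_decomposition _ _ _ iota R [:: (1, 3)]%N (fun=> M)).
- exact: (cubic_order_polynomial HC one0 A1 B1).
- move=> i; rewrite ord1 {i}; split=> //.
  + exact: (residue_kernel_maximal HC one0 A1 B1 compat).
  + exact: (residue_kernel_above HC one0 compat).
  pose e (j : nat) (i : 'I_3) : {poly k} := (val i == j)%:R.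
  pose i1 : 'I_3 := lift ord0 ord0; pose i2 : 'I_3 := lift ord0 (lift ord0 ord0).
  have resE (x : 'I_3 -> {poly k}) :
      \sum_i phi (x i) * residue_value phi eta (eta ^+ 2) (e 0%N i) (e 1%N i) (e 2%N i)
      = residue_value phi eta (eta ^+ 2) (x ord0) (x i1) (x i2).
    rewrite !big_ord_recl big_ord0 /residue_value /e /=.
    by rewrite !rmorph1 !rmorph0; ring.
  apply: (residue_degree_basis HC one0 compat (U := e 0%N) (V := e 1%N) (W := e 2%N)).
    by move=> u v w; exists (fun i : 'I_3 => nth 0 [:: u; v; w] i); rewrite resE.
  move=> x; rewrite resE => /free/residue_poly_eq0[x0 x1 x2] j.
  apply/eqP; rewrite /= fmorph_eq0 rho_eq0.
  by case: j => [[|[|[|j]]] Hj] //; [move: x0 | move: x1 | move: x2];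
    congr (is_true (P %| x _)); apply: val_inj.
- by move=> i j; rewrite !ord1.
- move=> z Mz; have [u [v [w [-> /free q0]]]] := Mz ord0.
  exact: residue_poly0_divisible.
Qed.


(** Composing with the identity makes the statements on extensions psi of kappa
    apply to kappa itself. *)
Definition point_ideal (r : kappa) : set L :=
  residue_kernel iota y 1 (idfun \o rho) r (r ^+ 2).

Lemma point_idealP r u v w :
  point_ideal r (el u v w) <-> (residue_poly u v w).[r] = 0.
Proof.
rewrite /point_ideal (residue_kernelP HC one0) residue_value_horner.
by rewrite map_poly_id.
Qed.

Lemma point_ideal_regular r : root fbar r ->
  [/\ maximal_ideal R (point_ideal r), point_ideal r (iota P)
    & residue_degree P iota R (point_ideal r) 1].
Proof.
move=> /eqP root_r.
have compat : residue_compatible 1 A B P (idfun \o rho : {rmorphism {poly k} -> kappa}) r (r ^+ 2).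
  by apply: unramified_compat; rewrite map_poly_id.
split.
- exact: (residue_kernel_maximal HC one0 A1 B1 compat).
- exact: (residue_kernel_above HC one0 compat).
- exact: (residue_degree1 HC one0 compat rho_surj).
Qed.

Lemma horner_residue_poly (x : kappa) u v w :
  (residue_poly u v w).[x] = rho u + rho v * x + rho w * x ^+ 2.
Proof. by rewrite horner_size3 ?size_residue_poly // !coef_Poly. Qed.

(** A polynomial of degree at most 2 with three roots vanishes, so the three
    corresponding primes intersect in P R. *)
Lemma decomposition_three_roots (r : 'I_3 -> kappa) : injective r ->
  (forall i, root fbar (r i)) -> prime_decomposition P iota R [:: (1, 1); (1, 1); (1, 1)]%N.
Proof.
move=> inj_r root_r; pose M i := point_ideal (r i).
apply: (@unramified_decomposition _ _ _ iota R [:: (1, 1); (1, 1); (1, 1)]%N M).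
- exact: (cubic_order_polynomial HC one0 A1 B1).
- move=> i; have [maxM MP deg1] := point_ideal_regular (root_r i).
  by split=> //; move: deg1; rewrite -/(M i); case: i {maxM MP} => [[|[|[|i]]] Hi].
- move=> i j ij; have [p pE] := rho_surj (r i).
  exists (el (- p) 1 0); split.
    apply/point_idealP; rewrite horner_residue_poly rmorphN pE rmorph1 rmorph0.
    by ring.
  move/point_idealP/eqP; rewrite horner_residue_poly rmorphN pE rmorph1 rmorph0.
  rewrite mul1r mul0r addr0 addrC subr_eq0 => /eqP/inj_r ji.
  by rewrite ji eqxx in ij.
- move=> z Mz; have [u [v [w [zE _]]]] := Mz ord0.
  have q0 : residue_poly u v w = 0.
    apply: (@roots_geq_poly_eq0 _ _ (map r (enum 'I_3))).
    - by apply/allP => _ /mapP[i _ ->]; apply/eqP/point_idealP; rewrite -zE; apply: Mz.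
    - by rewrite map_inj_uniq ?enum_uniq.
    - by rewrite size_map size_enum_ord size_residue_poly.
  by rewrite zE; apply: residue_poly0_divisible.
Qed.

(** The reduced cubic is (T - r) g with g = T^2 + r T + (r^2 - A) irreducible.
    Characteristic 3 gives g(r) = 3 r^2 - A = - A, which is nonzero, so the two
    factors are coprime and a multiple of both of degree at most 2 vanishes. *)
Lemma decomposition_one_root (r : kappa) : 3%:R = 0 :> kappa -> root fbar r ->
  (forall t, t ^+ 2 + r * t + (r ^+ 2 - rho A) != 0) ->
  prime_decomposition P iota R [:: (1, 1); (1, 2)]%N.
Proof.
move=> three0 root_r noroot.
pose g : {poly kappa} := 'X^2 + (r *: 'X + (r ^+ 2 - rho A)%:P).
have szl : (size (r *: 'X + (r ^+ 2 - rho A)%:P)%R <= 2)%N.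
  rewrite (leq_trans (size_polyD _ _)) // geq_max (leq_trans (size_polyC_leq1 _)) //.
  by rewrite (leq_trans (size_scale_leq _ _)) ?size_polyX.
have szg : size g = 3%N by rewrite /g size_polyDl size_polyXn.
have ghorner x : g.[x] = x ^+ 2 + r * x + (r ^+ 2 - rho A).
  by rewrite /g !hornerE; ring.
have gr : g.[r] != 0.
  have -> : g.[r] = 3%:R * r ^+ 2 - rho A by rewrite ghorner; ring.
  by rewrite three0 mul0r add0r oppr_eq0.
have hg : monic_irreducible_poly g.
  split.
    apply: cubic_irreducible; rewrite ?szg // => x.
    by rewrite rootE ghorner.
  by rewrite monicE lead_coefE szg /g !coefE /= mulr0 !addr0.
have [kappa' [psi [eta minp]]] := finite_extension hg.
have fE : fbar = ('X - r%:P) * g.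
  have /eqP E := root_r; rewrite horner_cubic in E.
  have BE : rho B = rho A * r - r ^+ 3.
    by apply/eqP; rewrite -subr_eq0 -[X in _ == X]E; apply/eqP; ring.
  rewrite /fbar /cubic /g BE -!mul_polyC !(rmorphB, rmorphM, rmorphXn) /=.
  by ring.
pose phi : {rmorphism {poly k} -> kappa'} := psi \o rho.
have compat : residue_compatible 1 A B P phi eta (eta ^+ 2).
  by apply: unramified_compat; apply/eqP; rewrite minp fE dvdp_mull.
pose M1 := point_ideal r; pose M2 : set L := residue_kernel iota y 1 phi eta (eta ^+ 2).
have M2P u v w : M2 (el u v w) <-> g %| residue_poly u v w.
  rewrite /M2 (residue_kernelP HC one0) residue_value_horner -minp.
  by split=> [->|/eqP].
have [max1 M1P deg1] := point_ideal_regular root_r.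
have [p pE] := rho_surj r.
have linear_free u v : g %| residue_poly u v 0 -> residue_poly u v 0 = 0.
  move=> dv; apply/eqP; apply: contraT => q0.
  have := dvdp_leq q0 dv; rewrite szg ltnNge; case/negP.
  apply/leq_sizeP => j; rewrite coef_Poly.
  by case: j => [|[|[|j]]] //= _; rewrite ?rmorph0 ?nth_nil.
pose M (i : 'I_2) : set L := if val i == 0%N then M1 else M2.
apply: (@unramified_decomposition _ _ _ iota R [:: (1, 1); (1, 2)]%N M).
- exact: (cubic_order_polynomial HC one0 A1 B1).
- have [max2 M2iP] : maximal_ideal R M2 /\ M2 (iota P).
    split; first exact: (residue_kernel_maximal HC one0 A1 B1 compat).
    exact: (residue_kernel_above HC one0 compat).
  have deg2 : residue_degree P iota R M2 2.
    pose e (j : nat) (i : 'I_2) : {poly k} := (val i == j)%:R.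
    pose i1 : 'I_2 := lift ord0 ord0.
    have resE (x : 'I_2 -> {poly k}) :
        \sum_i phi (x i) * residue_value phi eta (eta ^+ 2) (e 0%N i) (e 1%N i) 0
        = residue_value phi eta (eta ^+ 2) (x ord0) (x i1) 0.
      rewrite !big_ord_recl big_ord0 /residue_value /e /=.
      by rewrite !rmorph1 !rmorph0; ring.
    apply: (residue_degree_basis HC one0 compat (U := e 0%N) (V := e 1%N) (W := fun=> 0)).
      move=> u v w.
      (* Reduce by eta^2 = - r eta - (r^2 - A), where p lifts r. *)
      exists (fun i : 'I_2 => nth 0 [:: u - w * (p ^+ 2 - A); v - w * p] i).
      rewrite resE /=.
      have /eqP : (map_poly psi g).[eta] == 0 by rewrite minp.
      rewrite /g 2!rmorphD /= map_polyXn map_polyZ map_polyX map_polyC !hornerE /=.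
      rewrite -pE => /(congr1 (fun x => psi (rho w) * x)); rewrite mulr0 => E.
      apply/eqP; rewrite -subr_eq0 -[X in _ == X]E /residue_value /=.
      by rewrite !(rmorphB, rmorphM, rmorphXn, rmorph0) /=; apply/eqP; ring.
    move=> x; rewrite resE => /eqP.
    rewrite residue_value_horner minp => /linear_free/residue_poly_eq0[x0 x1 _] j.
    apply/eqP; rewrite /= fmorph_eq0 rho_eq0.
    by case: j => [[|[|j]] Hj] //; [move: x0 | move: x1];
      congr (is_true (P %| x _)); apply: val_inj.
  by case=> [[|[|i]] Hi].
- have M12 : M1 (el (- p) 1 0) /\ ~ M2 (el (- p) 1 0).
    split.
      apply/point_idealP; rewrite horner_residue_poly rmorphN pE rmorph1 rmorph0.
      by ring.
    move/M2P/linear_free/residue_poly_eq0 => [_ + _].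
    by rewrite -rho_eq0 rmorph1 oner_eq0.
  have gE : residue_poly (p ^+ 2 - A) p 1 = g.
    apply/polyP => j; rewrite coef_Poly /g !coefE.
    by case: j => [|[|[|j]]] //=; rewrite ?rmorphB ?rmorphXn ?rmorph1 ?pE ?nth_nil /=; ring.
  have M21 : M2 (el (p ^+ 2 - A) p 1) /\ ~ M1 (el (p ^+ 2 - A) p 1).
    split; first by apply/M2P; rewrite gE.
    by move/point_idealP; rewrite gE; apply/eqP.
  by case=> [[|[|i]] Hi] [[|[|j]] Hj] // _; rewrite /M /=; eexists; eassumption.
- move=> z Mz; have Mz1 : M1 z := Mz ord0; have Mz2 : M2 z := Mz ord_max.
  have [u [v [w zE]]] := ideal_sub max1 Mz1.
  move: Mz1 Mz2; rewrite zE => /point_idealP q1 /M2P q2.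
  suff q0 : residue_poly u v w = 0 by apply: residue_poly0_divisible.
  apply/eqP; apply: contraT => q0.
  have : fbar %| residue_poly u v w.
    rewrite fE Gauss_dvdp; last by rewrite coprimep_sym coprimep_XsubC rootE.
    by rewrite q2 dvdp_XsubCl rootE q1 eqxx.
  move/(dvdp_leq q0); rewrite size_cubic => le4.
  by have := leq_trans le4 (size_residue_poly u v w).
Qed.

End Unramified.
End Cases.

(** * Valuations of polynomials and the signature *)

(** The maximum defining vpoly ranges over exponents below size G, which is enough
    because P^N has size larger than N. *)
Lemma vpoly_spec (k : fieldType) (P G : {poly k}) : (1 < size P)%N ->
  (G = 0 /\ vpoly P G = +oo%E) \/
  (exists N s, [/\ G = P ^+ N * s, ~~ (P %| s) & vpoly P G = (N%:Z)%:E]).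
Proof.
move=> szP; have [->|G0] := eqVneq G 0; [left | right].
  by rewrite /vpoly eqxx.
have P0 : P != 0 by rewrite -size_poly_gt0 ltnW.
have [N [s [nPs GE]]] := irreducible_power_factor szP G0.
have PN0 i : P ^+ i != 0 by rewrite expf_neq0.
have dvE i : (P ^+ i %| G) = (i <= N)%N.
  apply/idP/idP => [|leiN]; last first.
    by rewrite GE -(subnKC leiN) exprD -mulrA dvdp_mulr.
  apply: contraLR; rewrite -ltnNge => ltNi.
  rewrite GE -(subnKC ltNi) exprD exprSr -mulrA dvdp_mul2l //.
  by apply: contra nPs; apply: dvdp_trans; apply: dvdp_mulr.
have ltN : (N < size G)%N.
  have dvN : P ^+ N %| G by rewrite dvE.
  apply: leq_trans (dvdp_leq G0 dvN).
  rewrite -[size _]prednK ?size_poly_gt0 // size_exp ltnS leq_pmull //.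
  by rewrite -ltnS prednK // ltnW.
exists N, s; split=> //; rewrite /vpoly (negPf G0); congr ((Posz _)%:E).
apply/eqP; rewrite eqn_leq; apply/andP; split.
  by apply/bigmax_leqP => i; rewrite dvE.
by apply: (bigop.bigmax_sup (Ordinal ltN)); rewrite ?dvE.
Qed.

Section ValuationAndDivisibility.
Variables (k : fieldType) (P : {poly k}).
Hypothesis szP : (1 < size P)%N.

Lemma le_vpoly G n : ((n%:Z)%:E <= vpoly P G)%E = (P ^+ n %| G).
Proof.
have P0 : P != 0 by rewrite -size_poly_gt0 ltnW.
have [[-> ->]|[N [s [GE nPs ->]]]] := vpoly_spec G szP.
  by rewrite leey dvdp0.
rewrite lee_fin lez_nat; apply/idP/idP => [leiN|].
  by rewrite GE -(subnKC leiN) exprD -mulrA dvdp_mulr.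
apply: contraLR; rewrite -ltnNge => ltNi.
rewrite GE -(subnKC ltNi) exprD exprSr -mulrA dvdp_mul2l ?expf_neq0 //.
by apply: contra nPs; apply: dvdp_trans; apply: dvdp_mulr.
Qed.

Lemma lt_vpoly G n : ((n%:Z)%:E < vpoly P G)%E = (P ^+ n.+1 %| G).
Proof.
rewrite -le_vpoly.
have [[_ ->]|[N [s [_ _ ->]]]] := vpoly_spec G szP; first by rewrite ltey leey.
by rewrite lte_fin lee_fin lez_nat ltz_nat.
Qed.

Lemma vpoly_eq G n : vpoly P G = (n%:Z)%:E -> P ^+ n %| G /\ ~~ (P ^+ n.+1 %| G).
Proof. by move=> E; rewrite -le_vpoly -lt_vpoly E lexx ltxx. Qed.

Lemma dvdp_of_le_vpoly G H n : (vpoly P G <= vpoly P H)%E -> P ^+ n %| G -> P ^+ n %| H.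
Proof. by rewrite -!le_vpoly => le_GH /le_trans; apply. Qed.

End ValuationAndDivisibility.

Theorem theorem2p2p8 (k : finFieldType) (char3 : 3%N \in [pchar k])
    (F : fieldExtType {fraction {poly k}}) (A B : {poly k}) (y : F)
    (HF : cubic_standard_form A B y)
    (P : {poly k}) (hP : monic_irreducible_poly P) :
  let m1 := vpoly P A in
  let m0 := vpoly P B in
  [/\ (m1 = 0 /\ (0 < m0)%E /\ square_mod hP A) \/
      (m1 = 0 /\ m0 = 0 /\ nroots_mod hP A B = 3%N) ->
        signature F P [:: (1, 1); (1, 1); (1, 1)]%N,
      (m1 = 0 /\ (0 < m0)%E /\ ~ square_mod hP A) \/
      (m1 = 0 /\ m0 = 0 /\ nroots_mod hP A B = 1%N) ->
        signature F P [:: (1, 1); (1, 2)]%N,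
      m1 = 1%E /\ (1 < m0)%E ->
        signature F P [:: (1, 1); (2, 1)]%N,
      m1 = 0 /\ m0 = 0 /\ nroots_mod hP A B = 0%N ->
        signature F P [:: (1, 3)]%N
    & (1 <= m0)%E /\ (m0 <= m1)%E ->
        signature F P [:: (3, 1)]%N].
Proof.
move=> m1 m0; have szP : (1 < size P)%N := hP.1.1.
have P0 : P != 0 by rewrite -size_poly_gt0 ltnW.
pose kappa := ({poly %/ P with hP} : finFieldType).
pose rA : kappa := in_qpoly P A; pose rB : kappa := in_qpoly P B.
have three0 : 3%:R = 0 :> kappa.
  have /(congr1 (fun x => in_qpoly P x%:P : kappa)) := pcharf0 char3.
  by rewrite !rmorph0 polyCMn polyC1 rmorph_nat.
have nPA : m1 = 0 -> ~~ (P %| A).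
  by move=> E; have [_] := vpoly_eq szP (n := 0) E; rewrite expr1.
have PB0 : (0 < m0)%E -> rB = 0.
  by rewrite (lt_vpoly szP B 0) expr1 -(in_qpoly_eq0 hP) => /eqP.
have rA0 : m1 = 0 -> rA != 0 by move=> /nPA; rewrite -(in_qpoly_eq0 hP).
have horner_f (t : kappa) : (cubic rA rB).[t] = t ^+ 3 - rA * t + rB by rewrite horner_cubic.
have HC := cubic_standard_basis HF.
have sig c a b (c0 : c != 0) (AE : A = c * a) (BE : B = c ^+ 2 * b) s : sorted <=%O s ->
    prime_decomposition P (poly_emb F) (cubic_order (poly_emb F) y c) s -> signature F P s.
  move=> ss; apply: (signature_of_decomposition hP ss).
    exact: (cubic_order_polynomial HC c0 AE BE).
  exact: (cubic_order_integral HC c0 AE BE).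
have AE1 : A = 1 * A by rewrite mul1r.
have BE1 : B = 1 ^+ 2 * B by rewrite expr1n mul1r.
have sig1 := sig 1 A B (oner_neq0 _) AE1 BE1.
split.
- case=> [[mA [mB [d dE]]] | [mA [_ nroots]]].
    have d0 : (d : kappa) != 0.
      by apply: contraNneq (rA0 mA) => d0; rewrite /rA -/(residue hP A) dE d0 expr0n.
    have rAE : rA = (d : kappa) ^+ 2 := dE.
    (* In characteristic 3 an element equal to its opposite vanishes. *)
    have dN : (d : kappa) != - d.
      apply: contraNneq d0 => dN; have -> : d = 3%:R * d - (d + d) :> kappa by ring.
      by rewrite three0 mul0r {2}dN subrr subr0.
    have uniq_r : uniq [:: 0; d : kappa; - d].
      by rewrite /= !inE ![0 == _]eq_sym oppr_eq0 (negPf d0) dN.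
    apply: sig1 => //.
    apply: (decomposition_three_roots HC (hP := hP)
      (r := fun i => nth 0 [:: 0; d : kappa; - d] i)).
      by move=> i j /eqP; rewrite (nth_uniq 0 _ _ uniq_r) ?ltn_ord // => /eqP/val_inj.
    by case=> [[|[|[|i]]] Hi] //=; rewrite rootE horner_f PB0 // rAE; apply/eqP; ring.
  pose r (i : 'I_3) : kappa := enum_val (cast_ord (esym nroots) i).
  apply: sig1 => //; apply: (decomposition_three_roots HC (hP := hP) (r := r)).
    by move=> i j /enum_val_inj/cast_ord_inj.
  by move=> i; have := enum_valP (cast_ord (esym nroots) i).
- case=> [[mA [mB nsq]] | [mA [_ nroots]]].
    apply: sig1 => //; apply: (decomposition_one_root HC (nPA mA) (r := 0) three0).
      by rewrite rootE horner_f PB0 //; apply/eqP; ring.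
    move=> t; rewrite mul0r addr0 expr0n add0r subr_eq0.
    by apply/eqP => tE; apply: nsq; exists t.
  have [r rE] := mem_card1 nroots.
  have root_r : (cubic rA rB).[r] = 0.
    by apply/eqP; have := rE r; rewrite !inE eqxx.
  apply: sig1 => //; apply: (decomposition_one_root HC (nPA mA) (r := r) three0); first exact/eqP.
  move=> t; apply/eqP => tE.
  have tr : t = r.
    have : (cubic rA rB).[t] == 0.
      rewrite -root_r !horner_f -subr_eq0.
      (* The difference of the values of the cubic at t and at its root r. *)
      rewrite (_ : _ - _ = (t - r) * (t ^+ 2 + r * t + (r ^+ 2 - rA))); last by ring.
      by rewrite tE mulr0.
    by move=> ft; apply/eqP; have := rE t; rewrite !inE => <-.
  have := rA0 mA; rewrite -oppr_eq0.
  have -> : - rA = (t ^+ 2 + r * t + (r ^+ 2 - rA)) - 3%:R * r ^+ 2 by rewrite tr; ring.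
  by rewrite tE three0 mul0r subr0 eqxx.
- case=> mA mB; have [/dvdpP[a aE] nP2A] := vpoly_eq szP (n := 1) mA.
  have : P ^+ 2 %| B by rewrite -lt_vpoly.
  case/dvdpP=> b bE.
  have AE : A = P * a by rewrite aE expr1 mulrC.
  have BE : B = P ^+ 2 * b by rewrite bE mulrC.
  apply: (sig P a b P0 AE BE) => //.
  apply: (decomposition_partially_ramified HC hP P0 AE BE erefl).
  by apply: contra nP2A => /dvdpP[a' a'E]; rewrite aE a'E expr1 -mulrA -expr2 dvdp_mull.
- case=> mA [_ /card0_eq nroots].
  apply: sig1 => //; apply: (decomposition_inert HC (hP := hP)) => r.
  by have := nroots r; rewrite !inE => ->.
- case=> m0_ge1 m0_le_m1.
  have PB : P %| B by rewrite -[P]expr1 -le_vpoly.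
  have PA : P %| A by rewrite -[P]expr1 (dvdp_of_le_vpoly szP m0_le_m1) ?expr1.
  have [P2B|nP2B] := boolP (P ^+ 2 %| B).
    have P2A := dvdp_of_le_vpoly szP m0_le_m1 P2B.
    have [[a aE] [b bE]] := (dvdpP _ _ P2A, dvdpP _ _ P2B).
    have AE : A = P * (a * P) by rewrite aE; ring.
    have BE : B = P ^+ 2 * b by rewrite bE; ring.
    apply: (sig P _ b P0 AE BE) => //.
    apply: (decomposition_totally_ramified_val2 HC hP P0 AE BE erefl erefl).
    apply/negP => /dvdpP[b' b'E]; have := csf_standard HF P2A.
    rewrite bE b'E -mulrA -exprS dvdp_mull // => /(_ isT).
    by rewrite leqNgt szP.
  have [[a aE] [b bE]] := (dvdpP _ _ PA, dvdpP _ _ PB).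
  apply: sig1 => //.
  apply: (decomposition_totally_ramified_val1 HC hP (oner_neq0 _) AE1 BE1 erefl aE bE).
  by apply: contra nP2B => /dvdpP[b' b'E]; rewrite bE b'E -mulrA -expr2 dvdp_mull.
Qed.
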